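(* Let $R\subset A$ be rings, where $R$ is an integral domain, and let $K$ be the field of fractions of $R$. Then: (1) If $X_1,\dots,X_n$ are algebraically independent over $A$ and $A$ contains elements $t_1,\dots,t_n$ that are algebraically independent over $R$, then $$\dim\big(K(X_1,\dots,X_n)\otimes_R A\big)\ \geq\ n+\dim S^{-1}A,$$ where $S=R[t_1,\dots,t_n]\setminus\{0\}$. Further, if $A$ is Noetherian, then $$\dim\big(K(X_1,\dots,X_n)\otimes_R A\big)\ \leq\ \dim A+n.$$ (2) If $X_1,X_2,\dots,X_n,\dots$ (an infinite sequence) are algebraically independent over $A$ and $A$ contains an infinite sequence of elements $t_1,t_2,\dots,t_n,\dots$ that are algebraically independent over $R$, then $$\dim\big(K(X_1,\dots,X_n,\dots)\otimes_R A\big)=\infty.$$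
   Context: All rings and algebras are commutative with identity $\neq 0$. $\dim$ denotes Krull dimension (possibly $\infty$). That $X_1,X_2,\dots$ are algebraically independent over $A$ means that they are indeterminates over $A$; $K(X_1,\dots,X_n)$ (resp. $K(X_1,\dots,X_n,\dots)$) is the field of rational functions over $K$ in these indeterminates. $S^{-1}A$ is the localization of $A$ at the multiplicatively closed subset $S$ of $A$. *)

(* Defs.v *)
From HB Require Import structures.
From mathcomp Require Import all_boot all_order all_algebra.
From mathcomp Require Import ring.
From mathcomp Require Import finmap monalg.
From mathcomp Require Import boolp classical_sets constructive_ereal.

Set Implicit Arguments.
Unset Strict Implicit.
Unset Printing Implicit Defensive.

Import GRing.Theory.

Local Open Scope ring_scope.
Local Open Scope quotient_scope.

(* Rings below may a priori be zero ([comPzRingType]), because localizations  *)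
(* and tensor products can be; the ideals of ring_quotient are not usable     *)
(* here since they are predicates on nonzero rings.                           *)
Section Ideals.
Variable A : comPzRingType.

Definition is_ideal (P : set A) : Prop :=
  [/\ P 0, forall x y, P x -> P y -> P (x + y) & forall a x, P x -> P (a * x)].

Definition is_prime_ideal (P : set A) : Prop :=
  [/\ is_ideal P, ~ P 1 & forall x y, P (x * y) -> P x \/ P y].

Definition span_ideal (n : nat) (g : 'I_n -> A) : set A :=
  [set x | exists c : 'I_n -> A, x = \sum_(i < n) c i * g i].

Definition noetherian : Prop :=
  forall P : set A, is_ideal P ->
    exists (n : nat) (g : 'I_n -> A), P = span_ideal g.

Definition prime_chain (n : nat) (P : nat -> set A) : Prop :=
  (forall i, (i <= n)%N -> is_prime_ideal (P i)) /\
  (forall i, (i < n)%N -> (P i `<` P i.+1)%classic).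

(* The supremum of the lengths of chains of primes, in the extended integers: *)
(* +oo when the lengths are unbounded, -oo for the zero ring.                 *)
Definition krull_dim : \bar int :=
  supremum -oo%E
    [set n%:Z%:E | n in [set n | exists P, prime_chain n P]]%classic.

End Ideals.

(* Localization at a multiplicatively closed set, without assuming that the   *)
(* ring is a domain or that 0 is not in S.                                    *)
Section Localization.
Variables (A : comPzRingType) (S : mulrClosed A).

Definition loc_frac : Type := (A * {s : A | s \in S})%type.

HB.instance Definition _ := Choice.on loc_frac.

Implicit Types u v w : loc_frac.

Definition loc_equiv u v : bool :=
  `[< exists2 s, s \in S & s * (u.1 * sval v.2) = s * (v.1 * sval u.2) >].

Lemma loc_equiv_is_equiv : equiv_class_of loc_equiv.
Proof.
split=> [u|u v|v u w].
- by apply/asboolP; exists 1; rewrite ?rpred1.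
- by apply/asboolP/asboolP => -[s sS e]; exists s.
- move=> /asboolP[s sS e] /asboolP[s' s'S e']; apply/asboolP.
  exists (s * s' * sval v.2); first by rewrite !rpredM // (valP v.2).
  transitivity (s' * sval w.2 * (s * (u.1 * sval v.2))); first by ring.
  rewrite e; transitivity (s * sval u.2 * (s' * (v.1 * sval w.2))); first by ring.
  by rewrite e'; ring.
Qed.

Canonical loc_equiv_equiv := EquivRelPack loc_equiv_is_equiv.

Definition localization : Type := {eq_quot loc_equiv}.

HB.instance Definition _ : EqQuotient loc_frac loc_equiv localization :=
  EqQuotient.on localization.
HB.instance Definition _ := Choice.on localization.

Definition loc_one : {s : A | s \in S} := exist _ 1 (rpred1 S).
Definition loc_mul (s s' : {s : A | s \in S}) : {s : A | s \in S} :=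
  exist _ (sval s * sval s') (rpredM (valP s) (valP s')).

Definition loc_frac0 : loc_frac := (0, loc_one).
Definition loc_frac1 : loc_frac := (1, loc_one).
Definition loc_fracN u : loc_frac := (- u.1, u.2).
Definition loc_fracD u v : loc_frac :=
  (u.1 * sval v.2 + v.1 * sval u.2, loc_mul u.2 v.2).
Definition loc_fracM u v : loc_frac := (u.1 * v.1, loc_mul u.2 v.2).

Definition loc0 : localization := \pi_localization loc_frac0.
Definition loc1 : localization := \pi_localization loc_frac1.
Definition locN (x : localization) : localization :=
  \pi_localization (loc_fracN (repr x)).
Definition locD (x y : localization) : localization :=
  \pi_localization (loc_fracD (repr x) (repr y)).
Definition locM (x y : localization) : localization :=
  \pi_localization (loc_fracM (repr x) (repr y)).

Lemma loc_eqP u v :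
  (exists2 s, s \in S & s * (u.1 * sval v.2) = s * (v.1 * sval u.2)) ->
  \pi_localization u = \pi_localization v.
Proof. by move=> h; apply/eqmodP/asboolP. Qed.

Lemma loc_reprP u : exists2 s, s \in S &
  s * ((repr (\pi_localization u)).1 * sval u.2) =
  s * (u.1 * sval (repr (\pi_localization u)).2).
Proof. by apply/asboolP; apply/(eqmodP loc_equiv_equiv); rewrite reprK. Qed.

Lemma locN_pi u : locN (\pi_localization u) = \pi_localization (loc_fracN u).
Proof.
have [s sS e] := loc_reprP u; apply: loc_eqP; exists s => //=.
by rewrite !mulNr !mulrN e.
Qed.

Lemma locD_pi u v : locD (\pi_localization u) (\pi_localization v) = \pi_localization (loc_fracD u v).
Proof.
have [s sS e] := loc_reprP u; have [s' s'S e'] := loc_reprP v.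
apply: loc_eqP; exists (s * s'); rewrite ?rpredM //=.
move: e e'; set u' := repr _; set v' := repr _ => e e'.
transitivity (s' * sval v.2 * sval v'.2 * (s * (u'.1 * sval u.2)) +
              s * sval u.2 * sval u'.2 * (s' * (v'.1 * sval v.2))); first by ring.
by rewrite e e'; ring.
Qed.

Lemma locM_pi u v : locM (\pi_localization u) (\pi_localization v) = \pi_localization (loc_fracM u v).
Proof.
have [s sS e] := loc_reprP u; have [s' s'S e'] := loc_reprP v.
apply: loc_eqP; exists (s * s'); rewrite ?rpredM //=.
move: e e'; set u' := repr _; set v' := repr _ => e e'.
transitivity ((s * (u'.1 * sval u.2)) * (s' * (v'.1 * sval v.2))); first by ring.
by rewrite e e'; ring.
Qed.

Lemma locDA : associative locD.
Proof.
elim/quotW=> u; elim/quotW=> v; elim/quotW=> w.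
rewrite (locD_pi v w) (locD_pi u v) !locD_pi.
by apply: loc_eqP; exists 1; rewrite ?rpred1 //=; ring.
Qed.

Lemma locDC : commutative locD.
Proof.
elim/quotW=> u; elim/quotW=> v; rewrite !locD_pi.
by apply: loc_eqP; exists 1; rewrite ?rpred1 //=; ring.
Qed.

Lemma loc0D : left_id loc0 locD.
Proof.
elim/quotW=> u; rewrite /loc0 !locD_pi.
by apply: loc_eqP; exists 1; rewrite ?rpred1 //=; ring.
Qed.

Lemma locND : left_inverse loc0 locN locD.
Proof.
elim/quotW=> u; rewrite /loc0 locN_pi !locD_pi.
by apply: loc_eqP; exists 1; rewrite ?rpred1 //=; ring.
Qed.

Lemma locMA : associative locM.
Proof.
elim/quotW=> u; elim/quotW=> v; elim/quotW=> w.
rewrite (locM_pi v w) (locM_pi u v) !locM_pi.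
by apply: loc_eqP; exists 1; rewrite ?rpred1 //=; ring.
Qed.

Lemma locMC : commutative locM.
Proof.
elim/quotW=> u; elim/quotW=> v; rewrite !locM_pi.
by apply: loc_eqP; exists 1; rewrite ?rpred1 //=; ring.
Qed.

Lemma loc1M : left_id loc1 locM.
Proof.
elim/quotW=> u; rewrite /loc1 !locM_pi.
by apply: loc_eqP; exists 1; rewrite ?rpred1 //=; ring.
Qed.

Lemma locMDl : left_distributive locM locD.
Proof.
elim/quotW=> u; elim/quotW=> v; elim/quotW=> w.
rewrite (locD_pi u v) (locM_pi u w) (locM_pi v w) locM_pi locD_pi.
by apply: loc_eqP; exists 1; rewrite ?rpred1 //=; ring.
Qed.

HB.instance Definition _ :=
  GRing.isZmodule.Build localization locDA locDC loc0D locND.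
HB.instance Definition _ :=
  GRing.Zmodule_isComPzRing.Build localization locMA locMC loc1M locMDl.

End Localization.

(* The tensor product of two commutative R-algebras, given by their structure *)
(* morphisms. An element of B (x)_R A is represented by a finite list of      *)
(* pairs (b, a), standing for the sum of the b (x) a; the signs of an integer *)
(* combination are absorbed in the first components. The congruence is        *)
(* generated by the relations presenting B (x)_R A as an abelian group.       *)
Section Tensor.
Variables (R B A : comPzRingType).
Variables (f : {rmorphism R -> B}) (g : {rmorphism R -> A}).

Definition tens_sum : Type := seq (B * A).

HB.instance Definition _ := Choice.on tens_sum.

Implicit Types u v w : tens_sum.

Inductive tens_rel : tens_sum -> tens_sum -> Prop :=
| tens_refl u : tens_rel u u
| tens_sym u v : tens_rel u v -> tens_rel v u
| tens_trans u v w : tens_rel u v -> tens_rel v w -> tens_rel u w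
| tens_cat u u' v v' :
    tens_rel u u' -> tens_rel v v' -> tens_rel (u ++ v) (u' ++ v')
| tens_catC u v : tens_rel (u ++ v) (v ++ u)
| tens_0l a : tens_rel [:: (0, a)] [::]
| tens_Dl b b' a : tens_rel [:: (b + b', a)] [:: (b, a); (b', a)]
| tens_Dr b a a' : tens_rel [:: (b, a + a')] [:: (b, a); (b, a')]
| tens_bal r b a : tens_rel [:: (f r * b, a)] [:: (b, g r * a)].

Definition tens_equiv u v : bool := `[< tens_rel u v >].

Lemma tens_equiv_is_equiv : equiv_class_of tens_equiv.
Proof.
split=> [u|u v|v u w].
- exact/asboolP/tens_refl.
- by apply/asboolP/asboolP; apply: tens_sym.
- by move=> /asboolP h /asboolP h'; apply/asboolP/(tens_trans h).
Qed.

Canonical tens_equiv_equiv := EquivRelPack tens_equiv_is_equiv.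

Definition tensor : Type := {eq_quot tens_equiv}.

HB.instance Definition _ : EqQuotient tens_sum tens_equiv tensor :=
  EqQuotient.on tensor.
HB.instance Definition _ := Choice.on tensor.

Definition tens_one : tens_sum := [:: (1, 1)].
Definition tens_opp u : tens_sum := [seq (- x.1, x.2) | x <- u].
Definition tens_mul u v : tens_sum :=
  [seq (x.1 * y.1, x.2 * y.2) | x <- u, y <- v].

Definition tensor0 : tensor := \pi_tensor [::].
Definition tensor1 : tensor := \pi_tensor tens_one.
Definition tensorN (x : tensor) : tensor := \pi_tensor (tens_opp (repr x)).
Definition tensorD (x y : tensor) : tensor := \pi_tensor (repr x ++ repr y).
Definition tensorM (x y : tensor) : tensor :=
  \pi_tensor (tens_mul (repr x) (repr y)).

Lemma tensor_eqP u v : tens_rel u v -> \pi_tensor u = \pi_tensor v.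
Proof. by move=> h; apply/eqmodP/asboolP. Qed.

Lemma tensor_reprP u : tens_rel (repr (\pi_tensor u)) u.
Proof. by apply/asboolP; apply/(eqmodP tens_equiv_equiv); rewrite reprK. Qed.

Lemma tens_perm u v : perm_eq u v -> tens_rel u v.
Proof.
elim: u v => [|x u IHu] v; first by rewrite perm_sym => /perm_nilP ->; exact: tens_refl.
move=> uv; have xv : x \in v by rewrite -(perm_mem uv) mem_head.
case/splitPr: xv uv => v1 v2; rewrite perm_sym perm_catC /= perm_cons => uv.
apply: (@tens_trans _ ([:: x] ++ (v2 ++ v1))); last first.
  exact: (tens_catC (x :: v2) v1).
apply: (@tens_cat [:: x]); first exact: tens_refl.
by apply: IHu; rewrite perm_sym.
Qed.

Lemma tens_oppP u v : tens_rel u v -> tens_rel (tens_opp u) (tens_opp v).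
Proof.
elim=> {u v} [u|u v _ h|u v w _ h _|u u' v v' _ h _ h'|u v|a|b b' a|b a a'|r b a].
- exact: tens_refl.
- exact: tens_sym.
- exact: tens_trans.
- by rewrite /tens_opp !map_cat; apply: tens_cat.
- by rewrite /tens_opp !map_cat; apply: tens_catC.
- by rewrite /= oppr0; apply: tens_0l.
- by rewrite /= opprD; apply: tens_Dl.
- exact: tens_Dr.
- by rewrite /= -mulrN; apply: tens_bal.
Qed.

Lemma tens_mul_cons x u v :
  tens_mul (x :: u) v = [seq (x.1 * y.1, x.2 * y.2) | y <- v] ++ tens_mul u v.
Proof. by []. Qed.

Lemma tens_mulDl u v w : tens_mul (u ++ v) w = tens_mul u w ++ tens_mul v w.
Proof. exact: allpairs_cat. Qed.

Lemma tens_mulC u v : tens_rel (tens_mul u v) (tens_mul v u).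
Proof.
apply: tens_perm; elim: u => [|x u IHu] /=.
  by rewrite /tens_mul; elim: v.
rewrite perm_sym /tens_mul (perm_allpairs_consr _ _ (fun=> x) (fun=> u)).
rewrite perm_sym allpairs_cons perm_cat //.
by under eq_map do rewrite mulrC [X in (_, X)]mulrC.
Qed.

Lemma tens_mulP1 y u u' : tens_rel u u' ->
  tens_rel (tens_mul u [:: y]) (tens_mul u' [:: y]).
Proof.
elim=> {u u'} [u|u v _ h|u v w _ h _|u u' v v' _ h _ h'|u v|a|b b' a|b a a'|r b a].
- exact: tens_refl.
- exact: tens_sym.
- exact: tens_trans.
- by rewrite /tens_mul !allpairs_cat; apply: tens_cat.
- by rewrite /tens_mul !allpairs_cat; apply: tens_catC.
- by rewrite /tens_mul /= mul0r; apply: tens_0l.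
- by rewrite /tens_mul /= mulrDl; apply: tens_Dl.
- by rewrite /tens_mul /= mulrDl; apply: tens_Dr.
- by rewrite /tens_mul /= -!mulrA; apply: tens_bal.
Qed.

Lemma tens_mulPl v u u' : tens_rel u u' ->
  tens_rel (tens_mul u v) (tens_mul u' v).
Proof.
move=> uu'; elim: v => [|y v IHv].
  by rewrite /tens_mul !allpairs0r; apply: tens_refl.
have split_cons w :
    tens_rel (tens_mul w (y :: v)) (tens_mul w [:: y] ++ tens_mul w v).
  apply: tens_perm.
  rewrite /tens_mul (perm_allpairs_consr _ _ (fun=> y) (fun=> v)).
  by rewrite allpairs1r.
apply: tens_trans (split_cons u) _; apply/tens_sym/(tens_trans (split_cons u')).
by apply/tens_sym/tens_cat => //; apply: tens_mulP1.
Qed.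

Lemma tensorN_pi u : tensorN (\pi_tensor u) = \pi_tensor (tens_opp u).
Proof. exact/tensor_eqP/tens_oppP/tensor_reprP. Qed.

Lemma tensorD_pi u v : tensorD (\pi_tensor u) (\pi_tensor v) = \pi_tensor (u ++ v).
Proof. by apply/tensor_eqP/tens_cat; apply: tensor_reprP. Qed.

Lemma tensorM_pi u v : tensorM (\pi_tensor u) (\pi_tensor v) = \pi_tensor (tens_mul u v).
Proof.
apply/tensor_eqP/(tens_trans (tens_mulPl _ (tensor_reprP u))).
apply: tens_trans (tens_mulC _ _) _; apply: tens_trans _ (tens_mulC _ _).
exact/tens_mulPl/tensor_reprP.
Qed.

Lemma tensorDA : associative tensorD.
Proof.
elim/quotW=> u; elim/quotW=> v; elim/quotW=> w.
by rewrite (tensorD_pi v w) (tensorD_pi u v) !tensorD_pi catA.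
Qed.

Lemma tensorDC : commutative tensorD.
Proof.
elim/quotW=> u; elim/quotW=> v; rewrite !tensorD_pi.
exact/tensor_eqP/tens_catC.
Qed.

Lemma tensor0D : left_id tensor0 tensorD.
Proof. by elim/quotW=> u; rewrite tensorD_pi. Qed.

Lemma tensorND : left_inverse tensor0 tensorN tensorD.
Proof.
elim/quotW=> u; rewrite tensorN_pi tensorD_pi; apply: tensor_eqP.
elim: u => [|[b a] u IHu]; first exact: tens_refl.
apply: (@tens_trans _ ([:: (- b, a); (b, a)] ++ (tens_opp u ++ u))).
  apply: tens_perm; rewrite /= perm_cons -cat_cons -cat1s perm_catCA.
  by rewrite perm_cat2l.
apply: (@tens_trans _ ([::] ++ [::])); last exact: tens_refl.
apply: tens_cat IHu; apply: tens_trans (tens_sym (tens_Dl _ _ _)) _.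
by rewrite addNr; apply: tens_0l.
Qed.

Lemma tensorMA : associative tensorM.
Proof.
elim/quotW=> u; elim/quotW=> v; elim/quotW=> w.
rewrite (tensorM_pi v w) (tensorM_pi u v) !tensorM_pi.
congr \pi; elim: u => [|x u IHu] //.
rewrite !tens_mul_cons tens_mulDl IHu.
congr (_ ++ _); elim: v {IHu} => [|y v IHv] //.
rewrite /= !tens_mul_cons map_cat IHv -map_comp.
by congr (_ ++ _); apply: eq_map => z /=; rewrite !mulrA.
Qed.

Lemma tensorMC : commutative tensorM.
Proof.
elim/quotW=> u; elim/quotW=> v; rewrite !tensorM_pi.
exact/tensor_eqP/tens_mulC.
Qed.

Lemma tensor1M : left_id tensor1 tensorM.
Proof.
elim/quotW=> u; rewrite tensorM_pi; congr (\pi_tensor _).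
rewrite /tens_mul allpairs1l -[RHS]map_id.
by apply: eq_map => -[b a] /=; rewrite !mul1r.
Qed.

Lemma tensorMDl : left_distributive tensorM tensorD.
Proof.
elim/quotW=> u; elim/quotW=> v; elim/quotW=> w.
rewrite (tensorD_pi u v) (tensorM_pi u w) (tensorM_pi v w).
by rewrite tensorM_pi tensorD_pi tens_mulDl.
Qed.

HB.instance Definition _ :=
  GRing.isZmodule.Build tensor tensorDA tensorDC tensor0D tensorND.
HB.instance Definition _ :=
  GRing.Zmodule_isComPzRing.Build tensor tensorMA tensorMC tensor1M tensorMDl.

End Tensor.

Section Evaluation.
Variables (R A : comNzRingType) (iota : {rmorphism R -> A}).
Variables (I : choiceType) (t : I -> A).

Definition cmonom_eval (m : {cmonom I}) : A :=
  \prod_(i <- finsupp m) t i ^+ m i.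

Lemma cmonom_evalE (d : {fset I}) (m : {cmonom I}) : (finsupp m `<=` d)%fset ->
  cmonom_eval m = \prod_(i <- d) t i ^+ m i.
Proof.
move=> le; apply: big_fset_incl => // i _.
by rewrite -cmE_neq0 negbK => /eqP ->; rewrite expr0.
Qed.

Lemma cmonom_eval_mmorphism : mmorphism cmonom_eval.
Proof.
split=> [m m'|]; last by rewrite /cmonom_eval mdom1 big_seq_fset0.
rewrite (cmonom_evalE (fsubsetUl (finsupp m) (finsupp m'))).
rewrite (cmonom_evalE (fsubsetUr (finsupp m) (finsupp m'))) /cmonom_eval mdomD.
by rewrite -big_split /=; apply: eq_bigr => i _; rewrite cmM exprD.
Qed.

HB.instance Definition _ :=
  monalg.isMultiplicative.Build {cmonom I} A cmonom_eval cmonom_eval_mmorphism.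

Definition pol_eval : {malg R[{cmonom I}]} -> A := mmap iota cmonom_eval.

HB.instance Definition _ := GRing.RMorphism.on pol_eval.

Definition alg_independent : Prop :=
  forall p : {malg R[{cmonom I}]}, pol_eval p = 0 -> p = 0.

End Evaluation.

(* Polynomials in any set I of variables over a domain form a domain. For two *)
(* given nonzero polynomials, a Kronecker substitution 'X_(s_j) := 'X^(D^j)   *)
(* with D large maps them to nonzero univariate polynomials.                  *)
Section MalgIdomain.
Variables (R : idomainType) (I : choiceType).

Local Notation pol := {malg R[{cmonom I}]}.

Fixpoint kron_weight (D : nat) (s : seq I) (m : {cmonom I}) : nat :=
  if s is i :: s' then (m i + D * kron_weight D s' m)%N else 0%N.

Lemma kron_weightM D s m m' :
  kron_weight D s (mmul m m') = (kron_weight D s m + kron_weight D s m')%N.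
Proof. by elim: s => //= i s ->; rewrite cmM mulnDr addnACA. Qed.

Lemma kron_weight1 D s : kron_weight D s mone = 0%N.
Proof. by elim: s => //= i s ->; rewrite cm1 muln0. Qed.

Lemma kron_weight_inj D s (m m' : {cmonom I}) :
  (forall i, m i < D)%N -> (forall i, m' i < D)%N ->
  kron_weight D s m = kron_weight D s m' -> {in s, m =1 m'}.
Proof.
move=> mD m'D; elim: s => //= i s IHs e.
have D_gt0 : (0 < D)%N by apply: leq_ltn_trans (mD i).
have ei : m i = m' i.
  by move/(congr1 (modn^~ D)): e; rewrite ![(D * _)%N]mulnC ![(_ + _ * D)%N]addnC !modnMDl !modn_small.
have es : kron_weight D s m = kron_weight D s m'.
  by move/eqP: e; rewrite ei eqn_add2l eqn_pmul2l // => /eqP.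
by move=> j; rewrite in_cons => /predU1P[-> //|]; apply: IHs.
Qed.

Definition kron_monom (D : nat) (s : seq I) (m : {cmonom I}) : {poly R} :=
  'X^(kron_weight D s m).

Lemma kron_monom_mmorphism D s : mmorphism (kron_monom D s).
Proof.
by split=> [m m'|]; rewrite /kron_monom ?kron_weightM ?exprD ?kron_weight1.
Qed.

HB.instance Definition _ D s := monalg.isMultiplicative.Build
  {cmonom I} {poly R} (kron_monom D s) (kron_monom_mmorphism D s).

Definition kron (D : nat) (s : seq I) : pol -> {poly R} :=
  mmap polyC (kron_monom D s).

HB.instance Definition _ D s := GRing.RMorphism.on (kron D s).

Lemma kron_neq0 D s (p : pol) :
  (forall m, m \in msupp p -> {subset finsupp m <= s}) ->
  (forall m, m \in msupp p -> forall i, (m i < D)%N) ->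
  p != 0 -> kron D s p != 0.
Proof.
move=> ps pD p_neq0.
have [m0 m0p] : exists m, m \in msupp p.
  apply: contra_notP (elimN eqP p_neq0) => h; apply/malgP => m.
  by rewrite mcoeff0; apply: mcoeff_outdom; apply/negP => mp; apply: h; exists m.
apply/eqP => /(congr1 (fun q : {poly R} => q`_(kron_weight D s m0))).
rewrite /kron mmapE coef_sum coef0 (big_fsetD1 m0) //= coefCM coefXn eqxx mulr1.
rewrite big1_fset ?addr0 => [/eqP|m]; first by rewrite mcoeff_eq0 m0p.
rewrite in_fsetD1 => /andP[m_neq mp] _; rewrite coefCM coefXn.
case: eqP => [e|]; last by rewrite mulr0.
case/eqP: m_neq; apply/eqP/cmP => i.
have mm0 := kron_weight_inj (pD m mp) (pD m0 m0p) (esym e).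
have [im|/negPf im] := boolP (i \in finsupp m); first exact/mm0/(ps m).
have [im0|/negPf im0] := boolP (i \in finsupp m0); first exact/mm0/(ps m0).
by move: im im0; rewrite -!cmE_neq0 => /negbFE/eqP -> /negbFE/eqP ->.
Qed.

Lemma malg_mulf_eq0 (p q : pol) : p * q = 0 -> (p == 0) || (q == 0).
Proof.
move=> pq0; apply/norP => -[p_neq0 q_neq0].
pose ms := enum_fset (msupp p) ++ enum_fset (msupp q).
pose s := flatten [seq enum_fset (finsupp m) | m : {cmonom I} <- ms].
pose D := (\max_(m <- ms) mdeg m).+1.
have hs m : m \in ms -> {subset finsupp m <= s}.
  by move=> mms i im; apply/flatten_mapP; exists m.
have hD m : m \in ms -> forall i, (m i < D)%N.
  move=> mms i; rewrite ltnS.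
  apply: leq_trans _ (leq_bigmax_seq _ mms isT).
  have [im|] := boolP (i \in finsupp m); last by rewrite -cmE_neq0 negbK => /eqP->.
  by rewrite /mdeg (big_fsetD1 i) //= leq_addr.
have msp m : m \in msupp p -> m \in ms by rewrite mem_cat => ->.
have msq m : m \in msupp q -> m \in ms by rewrite mem_cat orbC => ->.
have : kron D s p * kron D s q != 0.
  by rewrite mulf_neq0 // kron_neq0 // => m => [/msp|/msp|/msq|/msq]; auto.
by rewrite -rmorphM pq0 rmorph0 eqxx.
Qed.

Definition malg_unit : {pred pol} := [pred p | `[< exists q, q * p = 1 >]].
Definition malg_inv (p : pol) : pol := xget p [set q | q * p = 1]%classic.

Lemma malg_mulVr : {in malg_unit, left_inverse 1 malg_inv *%R}.
Proof.
move=> p /asboolP[q qp]; rewrite /malg_inv.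
by case: xgetP => [r _ rp|/(_ q) nq]; [exact: rp | case: (nq qp)].
Qed.

Lemma malg_unitP (p q : pol) : q * p = 1 -> malg_unit p.
Proof. by move=> qp; apply/asboolP; exists q. Qed.

Lemma malg_inv_out : {in [predC malg_unit], malg_inv =1 id}.
Proof.
move=> p /asboolPn np; rewrite /malg_inv.
by case: xgetP => [q _ qp|_]; [case: np; exists q | reflexivity].
Qed.

HB.instance Definition _ := GRing.ComNzRing_hasMulInverse.Build
  (malg {cmonom I} R) malg_mulVr malg_unitP malg_inv_out.
HB.instance Definition _ := GRing.ComUnitRing_isIntegral.Build
  (malg {cmonom I} R) malg_mulf_eq0.

End MalgIdomain.

(* The field K(X_i : i in I), for K the fraction field of R. *)
Definition ratfun (R : idomainType) (I : choiceType) : fieldType :=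
  {fraction {malg {fraction R}[{cmonom I}]}}.

Definition ratfun_of (R : idomainType) (I : choiceType) :
    {rmorphism R -> ratfun R I} :=
  @FracField.tofrac {malg {fraction R}[{cmonom I}]}
    \o (@malgC {cmonom I} {fraction R} \o @FracField.tofrac R).

Section Adjoin.
Variables (R : idomainType) (A : comNzRingType) (iota : {rmorphism R -> A}).
Variables (I : choiceType) (t : I -> A).

Definition adjoin_nz_pred : {pred A} :=
  [pred a | `[< (exists p, a = pol_eval iota t p) /\ a <> 0 >]].

Hypothesis t_indep : alg_independent iota t.

Lemma adjoin_nz_mulr_closed : mulr_closed adjoin_nz_pred.
Proof.
split=> [|a b].
  by apply/asboolP; split; [exists 1; rewrite rmorph1 | apply/eqP/oner_neq0].
move=> /asboolP[[p ->] p0] /asboolP[[q ->] q0]; apply/asboolP.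
rewrite -rmorphM; split; first by exists (p * q).
move/t_indep/eqP; rewrite mulf_eq0 => /orP[]/eqP e.
  by case: p0; rewrite e rmorph0.
by case: q0; rewrite e rmorph0.
Qed.

Definition adjoin_nz : mulrClosed A :=
  HB.pack adjoin_nz_pred
    (GRing.isMulClosed.Build A adjoin_nz_pred adjoin_nz_mulr_closed).

End Adjoin.

(* Main.v *)
Require Import Defs.
From HB Require Import structures.
From mathcomp Require Import all_boot all_order all_algebra.
From mathcomp Require Import ring zify.
From mathcomp Require Import finmap monalg.
From mathcomp Require Import boolp classical_sets constructive_ereal.

(* Write C = A[X_i : i in I] and T = R[X_i : i in I] \ {0}; the ring          *)
(* K(X_i) (x)_R A is the localization T^-1 C.                                 *)
(*                                                                            *)
(* Lower bounds. Let P_0 < ... < P_m be primes of A not meeting R[t] \ {0}.   *)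
(* Their inverse images under C -> A, X_i |-> t_i, do not meet T. Below the   *)
(* inverse image of P_0 lie the kernels of the maps C -> (A/P_0)[X] sending   *)
(* the first k variables to the t_i and fixing the others; X_k - t_k          *)
(* separates two consecutive kernels. With n variables this is a chain of     *)
(* length n + m; with infinitely many, start from any prime avoiding          *)
(* R[t] \ {0}.                                                                *)
(*                                                                            *)
(* Upper bound. Primes of T^-1 C contract injectively to C, so it is enough   *)
(* that dim A[X] <= dim A + 1 for noetherian A. Let Q_0 < ... < Q_m be primes *)
(* of A[X] with m >= 2. A fibre over a prime of A contains no chain of length *)
(* 2, so some a in A lies in Q_m but not in Q_0. By Krull's principal ideal   *)
(* theorem the chain can be replaced by one of the same length, with the same *)
(* ends, in which a is in Q_1. Then Q_0 and Q_1 have distinct contractions,   *)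
(* and induction applies to the chain starting at Q_1.                        *)

Set Implicit Arguments.
Unset Strict Implicit.
Unset Printing Implicit Defensive.

Import Order.TTheory GRing.Theory Num.Theory.

Local Open Scope classical_set_scope.
Local Open Scope ring_scope.

(** * Krull's principal ideal theorem *)

(** Both bounds compare the tensor product with polynomial rings over [A] through morphisms that are
    surjective up to units ([fraction_surjective]); contraction along such a morphism keeps strict
    inclusions of primes strict ([preimage_proper]). [tensor_localization] maps the tensor product
    to the localization of A[X_i] at the nonzero polynomials over [R], so a chain of primes of
    A[X_i] avoiding these polynomials yields one in the tensor product. In the other direction,
    [iter_poly_tensor] maps A[X_1]...[X_n] to the tensor product, whose chains therefore contract to
    chains of A[X_1]...[X_n].

    Lower bound ([tensor_prime_chain_lift]): independence of the t_i makes a nonzero polynomial over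
    [R] evaluate to an element of R[t] \ {0}, so pulled back primes avoid it. Each variable adds one
    link below.

    Upper bound ([pchain_poly]): passing from A[X] to [A] costs at most one link. This rests on
    [fibre_dimension], on the rerouting of chains in [pchain_through], and on [hilbert_basis], which
    makes the principal ideal theorem available in A[X]. That theorem is proved inside the ring
    itself: saturated ideals stand for ideals of a local ring, and stabilization of descending
    chains stands for finite length. *)

Section IdealTheory.
Variable B : comPzRingType.
Implicit Types (I J M N P Q : set B).

Lemma ideal0 I : is_ideal I -> I 0. Proof. by case. Qed.
Lemma idealD I x y : is_ideal I -> I x -> I y -> I (x + y).
Proof. by case=> _ h _; apply: h. Qed.
Lemma idealM I a x : is_ideal I -> I x -> I (a * x).
Proof. by case=> _ _; apply. Qed.
Lemma ideal_mulr I a x : is_ideal I -> I x -> I (x * a).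
Proof. by rewrite mulrC; apply: idealM. Qed.
Lemma idealN I x : is_ideal I -> I x -> I (- x).
Proof. by move=> iI Ix; rewrite -mulN1r; apply: idealM. Qed.
Lemma idealB I x y : is_ideal I -> I x -> I y -> I (x - y).
Proof. by move=> iI Ix Iy; apply: idealD => //; apply: idealN. Qed.
Lemma ideal_sum I (T : Type) (s : seq T) (F : T -> B) :
  is_ideal I -> (forall i, I (F i)) -> I (\sum_(i <- s) F i).
Proof.
by move=> iI IF; apply: big_ind => // [|x y]; [apply: ideal0|apply: idealD].
Qed.

Lemma ideal_setI I J : is_ideal I -> is_ideal J -> is_ideal (I `&` J).
Proof.
move=> iI iJ; split=> [|x y [Ix Jx] [Iy Jy]|a x [Ix Jx]].
- by split; apply: ideal0.
- by split; apply: idealD.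
- by split; apply: idealM.
Qed.

Lemma prime_idealW P : is_prime_ideal P -> is_ideal P. Proof. by case. Qed.
Lemma primeN1 P : is_prime_ideal P -> ~ P 1. Proof. by case. Qed.
Lemma primeM P x y : is_prime_ideal P -> P (x * y) -> P x \/ P y.
Proof. by case=> _ _; apply. Qed.
Lemma primeMN P x y : is_prime_ideal P -> ~ P x -> P (x * y) -> P y.
Proof. by move=> pP Px /(primeM pP)[]. Qed.
Lemma primeNM P x y : is_prime_ideal P -> ~ P x -> ~ P y -> ~ P (x * y).
Proof. by move=> pP Px Py /(primeM pP)[]. Qed.
Lemma primeX P x n : is_prime_ideal P -> P (x ^+ n) -> P x.
Proof.
move=> pP; elim: n => [/(primeN1 pP)//|n IHn].
by rewrite exprS => /(primeM pP)[].
Qed.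

Lemma span_ideal_gen n (g : 'I_n -> B) i : span_ideal g (g i).
Proof.
exists (fun j => (j == i)%:R); rewrite (bigD1 i) //= eqxx mul1r big1 ?addr0 //.
by move=> j /negPf ->; rewrite mul0r.
Qed.

Lemma span_ideal_sub n (g : 'I_n -> B) I :
  is_ideal I -> (forall i, I (g i)) -> span_ideal g `<=` I.
Proof.
by move=> iI Ig _ [c ->]; apply: ideal_sum => // i; apply: idealM.
Qed.

(** Minimality is tested on the span of [s]. Stating generation by minimality lets lists of
    generators be concatenated freely. *)
Lemma finitely_generated I (s : seq B) : is_ideal I ->
  {in s, forall f, I f} ->
  (forall J : set B, is_ideal J -> {in s, forall f, J f} -> I `<=` J) ->
  exists n (g : 'I_n -> B), I = span_ideal g.
Proof.
move=> iI Is minI; exists (size s), (fun i => s`_i); apply/seteqP; split.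
  apply: minI => [|f /(nthP 0)[i si <-]]; last exact: (span_ideal_gen _ (Ordinal si)).
  split=> [|_ _ [c ->] [c' ->]|a _ [c ->]].
  - by exists (fun=> 0); rewrite big1 // => i _; rewrite mul0r.
  - exists (fun i => c i + c' i); rewrite -big_split.
    by apply: eq_bigr => i _; rewrite mulrDl.
  - exists (fun i => a * c i); rewrite mulr_sumr.
    by apply: eq_bigr => i _; rewrite mulrA.
by apply: span_ideal_sub => // i; apply: Is; apply: mem_nth.
Qed.

Lemma chain_common_member (F : set (set B)) n (g : 'I_n -> B) :
  total_on F subset -> F !=set0 -> (forall i, (\bigcup_(X in F) X) (g i)) ->
  exists2 X, F X & forall i, X (g i).
Proof.
move=> totF [X0 FX0] gU.
suff [X FX gX] : exists2 X, F X & forall i : 'I_n, i \in enum 'I_n -> X (g i).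
  by exists X => // i; apply: gX; rewrite mem_enum.
elim: (enum _) => [|i s [X FX gX]]; first by exists X0.
have [Y FY Ygi] := gU i.
have [XY|YX] := totF _ _ FX FY; [exists Y|exists X] => // j; rewrite in_cons.
  by move=> /predU1P[->//|/gX/XY].
by move=> /predU1P[->//|/gX//]; exact: YX.
Qed.

Lemma noetherian_maximal (F : set (set B)) : noetherian B ->
  (forall I, F I -> is_ideal I) -> F !=set0 ->
  exists2 M, F M & forall I, F I -> M `<=` I -> I `<=` M.
Proof.
move=> nB iF [I0 FI0].
(* The empty set is adjoined to [F] to cover the union of the empty chain. *)
have [|M [FM Mmax]] := @Zorn_bigcup B (fun X => X = set0 \/ F X).
  move=> G GF totG.
  have [[X [GX FX]]|noF] := pselect (exists X, G X /\ F X); last first.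
    left; apply/seteqP; split=> // x [X GX Xx].
    have [X0|FX] := GF _ GX; first by move: Xx; rewrite X0.
    by case: noF; exists X.
  have GF' Y y : G Y -> Y y -> F Y.
    by move=> GY Yy; have [Y0|//] := GF _ GY; rewrite Y0 in Yy.
  have iU : is_ideal (\bigcup_(X in G) X).
    split=> [|x y [Y GY Yx] [Z GZ Zy]|a x [Y GY Yx]].
    - by exists X => //; apply: ideal0; apply: iF.
    - have [YZ|ZY] := totG _ _ GY GZ.
        by exists Z => //; apply: (idealD _ (YZ _ Yx) Zy); apply: iF; apply: GF' Zy.
      by exists Y => //; apply: (idealD _ Yx (ZY _ Zy)); apply: iF; apply: GF' Yx.
    - by exists Y => //; apply: (idealM _ _ Yx); apply: iF; apply: GF' Yx.
  have [n [g Ug]] := nB _ iU.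
  have [|Y GY Yg] := chain_common_member totG (ex_intro _ X GX) (n := n) (g := g).
    by move=> i; rewrite Ug; apply: span_ideal_gen.
  have eY : forall Z, G Z -> F Z -> (forall i, Z (g i)) -> \bigcup_(X in G) X = Z.
    move=> Z GZ FZ Zg; apply/seteqP; split; last by move=> z Zz; exists Z.
    by rewrite Ug; apply: span_ideal_sub => //; apply: iF.
  (* The union equals any member of [F] in the chain containing all the generators. [Y] contains
     them but may be empty when there are none, hence the comparison with [X]. *)
  right; have [XY|YX] := totG _ _ GX GY.
    have FY : F Y by apply: (GF' _ 0) => //; apply: XY; apply: ideal0; apply: iF.
    by rewrite (eY Y).
  by rewrite (eY X) // => i; apply: YX.
have {}FM : F M.
  case: FM => // M0; case: (Mmax I0); last by right.
  by rewrite M0; split=> // /(_ 0); apply; apply: ideal0; apply: iF.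
exists M => // I FI MI; apply: contrapT => IM.
by apply: (Mmax I) => //; right.
Qed.

(* Stability under division by elements outside the prime [Q], that is,       *)
(* being the contraction of an ideal of the local ring at [Q].                *)
Definition saturated Q I := forall s x, ~ Q s -> I (s * x) -> I x.

(** For prime [Q], the contraction of the extension of [I] to the local ring at [Q]. *)
Definition saturation Q I : set B := [set x | exists2 s, ~ Q s & I (s * x)].

Lemma saturation_ideal Q I : is_prime_ideal Q -> is_ideal I ->
  is_ideal (saturation Q I).
Proof.
move=> pQ iI; split=> [|x y [s Qs Isx] [s' Qs' Is'y]|a x [s Qs Isx]].
- by exists 1; [apply: primeN1|rewrite mulr0; apply: ideal0].
- exists (s * s'); first exact: primeNM.
  rewrite mulrDr; apply: idealD => //; last by rewrite -mulrA; apply: idealM.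
  by rewrite mulrAC; apply: ideal_mulr.
- by exists s => //; rewrite mulrCA; apply: idealM.
Qed.

Lemma saturation_saturated Q Q' I : is_prime_ideal Q -> Q `<=` Q' ->
  saturated Q' (saturation Q I).
Proof.
move=> pQ QQ' s x Qs [s' Qs' Is'sx]; exists (s' * s); last by rewrite -mulrA.
by apply: primeNM => // /QQ'.
Qed.

Lemma sub_saturation Q I : is_prime_ideal Q -> I `<=` saturation Q I.
Proof. by move=> pQ x Ix; exists 1; [apply: primeN1|rewrite mul1r]. Qed.

Definition sum_ideal I J : set B := [set x | exists y z, [/\ I y, J z & x = y + z]].

Lemma sum_idealP I J : is_ideal I -> is_ideal J -> is_ideal (sum_ideal I J).
Proof.
move=> iI iJ; split=> [|_ _ [y [z [Iy Jz ->]]] [y' [z' [Iy' Jz' ->]]]|].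
- by exists 0, 0; split; rewrite ?addr0 //; apply: ideal0.
- by exists (y + y'), (z + z'); split; [apply: idealD|apply: idealD|ring].
- move=> a _ [y [z [Iy Jz ->]]].
  by exists (a * y), (a * z); split; [apply: idealM|apply: idealM|ring].
Qed.

Lemma sum_ideall I J : is_ideal J -> I `<=` sum_ideal I J.
Proof. by move=> iJ x Ix; exists x, 0; rewrite addr0; split=> //; apply: ideal0. Qed.

Lemma sum_idealr I J : is_ideal I -> J `<=` sum_ideal I J.
Proof. by move=> iI x Jx; exists 0, x; rewrite add0r; split=> //; apply: ideal0. Qed.

Definition principal b : set B := [set x | exists r, x = r * b].

Lemma principal_ideal b : is_ideal (principal b).
Proof.
split=> [|_ _ [r ->] [r' ->]|a _ [r ->]]; first by exists 0; rewrite mul0r.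
  by exists (r + r'); ring.
by exists (a * r); ring.
Qed.

Lemma principal_gen b : principal b b. Proof. by exists 1; rewrite mul1r. Qed.

Definition colon I c : set B := [set a | I (a * c)].

Lemma colon_ideal I c : is_ideal I -> is_ideal (colon I c).
Proof.
move=> iI; split=> [|x y Ix Iy|a x Ix]; rewrite /colon /=.
- by rewrite mul0r; apply: ideal0.
- by rewrite mulrDl; apply: idealD.
- by rewrite -mulrA; apply: idealM.
Qed.

(** Existence of an associated prime: a maximal (I : c) with c outside [I] is prime. If xy lies in
    it and y does not, then (I : yc) is again such an ideal, contains (I : c), hence equals it, and
    contains x. *)
Lemma maximal_colon_prime I : noetherian B -> is_ideal I -> ~ I 1 ->
  exists b, ~ I b /\ is_prime_ideal (colon I b).
Proof.
move=> nB iI I1.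
have [|||M [c Ic ->] cmax] := @noetherian_maximal
    [set J | exists2 c, ~ I c & J = colon I c].
- exact: nB.
- by move=> _ [c _ ->]; apply: colon_ideal.
- by exists (colon I 1), 1.
exists c; split=> //; split=> [||x y xyc]; first exact: colon_ideal.
  by rewrite /colon /= mul1r.
have [|yc] := pselect (colon I c y); [by right|left].
apply: (cmax (colon I (y * c))) => //; first by exists (y * c).
  by move=> a ac; rewrite /colon /= mulrCA; apply: idealM.
by rewrite /colon /= mulrA.
Qed.

(** Nakayama's lemma for M/N over the local ring at [Q]. With N' maximal among the saturated ideals
    between [N] and [M] other than [M], the quotient M/N' is locally generated by any one g outside
    N', which reduces to the cyclic case. *)
Lemma nakayama_saturated Q N M x : noetherian B -> is_prime_ideal Q -> Q x ->
  is_ideal N -> is_ideal M -> N `<=` M -> saturated Q N -> saturated Q M ->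
  (forall a, M a -> exists2 s, ~ Q s & exists b c, [/\ N b, M c & s * a = b + x * c]) ->
  M `<=` N.
Proof.
move=> nB pQ Qx iN iM NM sN sM MNx; apply: contrapT => MN.
have [|||N' [iN' sN' NN' N'M MN'] N'max] := @noetherian_maximal
  [set J | [/\ is_ideal J, saturated Q J, N `<=` J, J `<=` M & ~ M `<=` J]].
- exact: nB.
- by move=> J [].
- by exists N; split.
have [g [Mg N'g]] := nonsubset MN'.
pose J := saturation Q (sum_ideal N' (principal g)).
have iN'g : is_ideal (sum_ideal N' (principal g)).
  by apply: sum_idealP => //; apply: principal_ideal.
have iJ : is_ideal J by apply: saturation_ideal.
have N'J : N' `<=` J.
  move=> z N'z; apply: sub_saturation => //.
  by apply: sum_ideall N'z; apply: principal_ideal.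
have Jg : J g.
  by apply: sub_saturation => //; apply: sum_idealr => //; apply: principal_gen.
have MJ : M `<=` J.
  apply: contrapT => nMJ; apply: N'g; apply: (N'max J) => //; split=> //.
  - exact: saturation_saturated.
  - exact: subset_trans NN' N'J.
  - move=> z [s Qs [y [_ [N'y [r ->] e]]]]; apply: (sM s) => //; rewrite e.
    by apply: idealD => //; [apply: N'M|apply: idealM].
have [s Qs [b [c [Nb Mc e]]]] := MNx g Mg.
have [s' Qs' [y [_ [N'y [r ->] e']]]] := MJ c Mc.
(* Locally g = xc and c = rg modulo N', so 1 - xr, a unit of the local ring, kills g. *)
apply: N'g; apply: (sN' (s' * s - x * r)).
  move=> Q1; apply: (primeNM pQ Qs' Qs).
  have iQ := prime_idealW pQ; rewrite -(subrK (x * r) (s' * s)).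
  by apply: idealD => //; apply: ideal_mulr.
have -> : (s' * s - x * r) * g = s' * b + x * y.
  transitivity (s' * (s * g) - x * (r * g)); first by ring.
  by rewrite e mulrDr [s' * (x * c)]mulrCA e'; ring.
by apply: idealD => //; apply: idealM => //; apply: NN'.
Qed.

(* The local ring at [Q], modulo [I], has finite length when [Q] is the only  *)
(* prime between [I] and [Q]; the largest ideal [M] such that descending      *)
(* chains stabilize inside [M] cannot be proper, since [M + b] with           *)
(* [M : b = Q] has one more simple layer.                                     *)
Lemma descending_saturated_stable Q I (J : nat -> set B) :
  noetherian B -> is_prime_ideal Q -> is_ideal I -> I `<=` Q ->
  (forall P, is_prime_ideal P -> I `<=` P -> P `<=` Q -> Q `<=` P) ->
  (forall n, [/\ is_ideal (J n), saturated Q (J n) & I `<=` J n]) ->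
  (forall m n, (m <= n)%N -> J n `<=` J m) ->
  exists n, J n `<=` J n.+1.
Proof.
move=> nB pQ iI IQ minQ hJ decJ.
have iJ n : is_ideal (J n) by have [] := hJ n.
have sJ n : saturated Q (J n) by have [] := hJ n.
pose stable M := exists N : nat, forall n, (N <= n)%N -> J N `&` M `<=` J n.
have iQ := prime_idealW pQ.
have [|||M [iM sM IM [N stM]] Mmax] := @noetherian_maximal
  [set M | [/\ is_ideal M, saturated Q M, I `<=` M & stable M]].
- exact: nB.
- by move=> M [].
- exists (saturation Q I); split.
  + exact: saturation_ideal.
  + exact: saturation_saturated.
  + exact: sub_saturation.
  + exists 0%N => n _ x [_ [s Qs Isx]]; apply: (sJ n s) => //.
    by have [_ _ ] := hJ n; apply.
(* If [M] is the whole ring, its stability is the claim. *)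
have [M1|M1] := pselect (M 1).
  exists N => x JNx; apply: (stM N.+1) => //; split=> //.
  by rewrite -(mulr1 x); apply: idealM.
exfalso; have [b [Mb pMb]] := maximal_colon_prime nB iM M1.
have MbQ a : colon M b a -> Q a.
  by move=> Mab; apply: contrapT => Qa; apply: Mb; apply: sM Mab.
have QMb : Q `<=` colon M b.
  apply: minQ => // x Ix; rewrite /colon /=; apply: ideal_mulr => //.
  exact: IM.
pose M' := saturation Q (sum_ideal M (principal b)).
have iMb : is_ideal (sum_ideal M (principal b)).
  by apply: sum_idealP => //; apply: principal_ideal.
have MM' : M `<=` M'.
  move=> z Mz; apply: sub_saturation => //.
  by apply: sum_ideall Mz; apply: principal_ideal.
apply: Mb; apply: (Mmax M') => //; last first.
  by apply: sub_saturation => //; apply: sum_idealr => //; apply: principal_gen.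
split=> //; first exact: saturation_ideal.
- exact: saturation_saturated.
- exact: subset_trans IM MM'.
have [[n1 Jn1]|noJ] := pselect (exists n, J n `&` M' `<=` M).
  exists (maxn N n1) => n; rewrite geq_max => /andP[Nn n1n] x [Jx M'x].
  apply: stM => //; split; first by apply: decJ Jx; apply: leq_maxl.
  by apply: Jn1; split=> //; apply: decJ Jx; apply: leq_maxr.
(* Every [J n] now contains some y of M' outside [M]; its coefficient r on b is not in [Q].
   Subtracting a multiple of y from a multiple of z cancels b, and the difference lies in [J N] and
   in [M], where stability applies. *)
exists N => n Nn z [JNz [s' Qs' [m' [_ [Mm' [r' ->] ez]]]]].
have [y [[Jny [s Qs [m [_ [Mm [r ->] ey]]]]] My]] :
    (J n `&` M') `&` ~` M !=set0.
  by apply: nonsubset => h; apply: noJ; exists n.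
have Qr : ~ Q r.
  move=> /QMb; rewrite /colon /= => Mrb; apply: My; apply: (sM s) => //.
  by rewrite ey; apply: idealD.
apply: (sJ n (r * s')); first exact: primeNM.
have Mw : M (r * s' * z - r' * s * y).
  rewrite -!mulrA ez ey.
  have -> : r * (m' + r' * b) - r' * (m + r * b) = r * m' - r' * m by ring.
  by apply: idealB => //; apply: idealM.
rewrite -(subrK (r' * s * y) (r * s' * z)); apply: idealD => //; last exact: idealM.
apply: (stM n Nn); split=> //; apply: idealB => //; apply: idealM => //.
exact: decJ Jny.
Qed.

(* The ideals Q1-saturation(Q0 + (u^n)), u in Q1 outside Q0, play the role of *)
(* the symbolic powers of Q1.                                                 *)
Lemma principal_ideal_theorem Q0 Q1 Q2 x : noetherian B ->
  is_prime_ideal Q0 -> is_prime_ideal Q1 -> is_prime_ideal Q2 ->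
  Q0 `<` Q1 -> Q1 `<` Q2 -> Q2 x -> ~ Q1 x ->
  exists P, [/\ is_prime_ideal P, Q0 `<=` P, P x & P `<` Q2].
Proof.
move=> nB pQ0 pQ1 pQ2 [Q01 Q10] [Q12 Q21] Q2x Q1x; apply: contrapT => noP.
have [u [Q1u Q0u]] := nonsubset Q10.
have iQ0 := prime_idealW pQ0; have iQ1 := prime_idealW pQ1.
have iQ2 := prime_idealW pQ2.
pose In n := saturation Q1 (sum_ideal Q0 (principal (u ^+ n))).
have iI n : is_ideal (In n).
  by apply: saturation_ideal => //; apply: sum_idealP => //; apply: principal_ideal.
have sI n : saturated Q2 (In n) by apply: saturation_saturated.
have Q0I n : Q0 `<=` In n.
  move=> z Q0z; apply: sub_saturation => //; apply: sum_ideall => //.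
  exact: principal_ideal.
have decI m n : (m <= n)%N -> In n `<=` In m.
  move=> mn z [s Qs [y [_ [Q0y [r ->] e]]]]; exists s => //.
  exists y, (r * u ^+ n); split=> //; exists (r * u ^+ (n - m)).
  by rewrite -mulrA -exprD subnK.
pose base := sum_ideal Q0 (principal x).
have ibase : is_ideal base by apply: sum_idealP => //; apply: principal_ideal.
pose Jn n := saturation Q2 (sum_ideal (In n) (principal x)).
(* The negated conclusion says that [Q2] is the only prime between Q0 + (x) and [Q2]. *)
have [||||n Jn1] := @descending_saturated_stable Q2 base Jn nB pQ2 ibase.
- move=> _ [y [_ [Q0y [r ->] ->]]].
  by apply: idealD => //; [apply: Q12; apply: Q01|apply: idealM].
- move=> P pP baseP PQ2; apply: contrapT => Q2P; apply: noP; exists P; split=> //.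
    by move=> z Q0z; apply: baseP; apply: sum_ideall => //; apply: principal_ideal.
  by apply: baseP; apply: sum_idealr => //; apply: principal_gen.
- move=> n; split.
  + by apply: saturation_ideal => //; apply: sum_idealP => //; apply: principal_ideal.
  + exact: saturation_saturated.
  + move=> _ [y [z [Q0y xz ->]]]; apply: sub_saturation => //.
    by exists y, z; split=> //; apply: Q0I.
- move=> m n mn z [s Qs [y [w [Iy xw e]]]]; exists s => //; exists y, w; split=> //.
  exact: decI Iy.
(* For a in [In n], stabilization gives sa = b + rx with b in [In n.+1]. Then rx is in [In n], and
   so is r because x is outside [Q1]; Nakayama applies. *)
have InS : In n `<=` In n.+1.
  apply: (@nakayama_saturated Q2 _ _ x) => //; first exact: decI.
  move=> a Ina.
  have [|s Qs [b [_ [Ib [r ->] e]]]] := Jn1 a.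
    by apply: sub_saturation => //; apply: sum_ideall => //; apply: principal_ideal.
  exists s => //; exists b, r; split=> //; last by rewrite [x * r]mulrC.
  have : In n (r * x).
    rewrite -(addKr b (r * x)) -e; apply: idealD => //; last exact: idealM.
    by apply: idealN => //; apply: decI Ib.
  by rewrite mulrC => -/(@saturation_saturated Q1 Q1 _ pQ1 (fun=> id) x r Q1x).
(* Now u^n (s - ru) lies in [Q0] with s outside [Q1]. As u is not in [Q0], s - ru is, and u in [Q1]
   forces s into [Q1]. *)
have [|s Qs [y [_ [Q0y [r ->] e]]]] := InS (u ^+ n).
  by apply: sub_saturation => //; apply: sum_idealr => //; apply: principal_gen.
have Q0su : Q0 (u ^+ n * (s - r * u)).
  suff -> : u ^+ n * (s - r * u) = y by [].
  by rewrite mulrBr [u ^+ n * s]mulrC e exprS; ring.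
have /(primeMN pQ0)/(_ Q0su) Q0s : ~ Q0 (u ^+ n) by move/(primeX pQ0).
apply: Qs; rewrite -(subrK (r * u) s); apply: idealD => //; first exact: Q01.
exact: idealM.
Qed.

(** Chains with both ends exposed and built from the bottom, suited to rerouting a chain between
    fixed ends. *)
Inductive pchain : nat -> set B -> set B -> Prop :=
| pchain0 P : is_prime_ideal P -> pchain 0 P P
| pchainS n P P' Q : is_prime_ideal P -> P `<` P' -> pchain n P' Q ->
    pchain n.+1 P Q.

Lemma prime_chain_pchain n (P : nat -> set B) :
  prime_chain n P -> pchain n (P 0%N) (P n).
Proof.
elim: n P => [|n IHn] P [pP ltP]; first exact: pchain0 (pP 0%N isT).
apply: pchainS (pP 0%N isT) (ltP 0%N isT) _.
apply: (IHn (fun i => P i.+1)); split=> i le_in; first exact: (pP i.+1).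
exact: (ltP i.+1).
Qed.

Lemma pchain_prime_chain n P Q : pchain n P Q ->
  exists2 F : nat -> set B, F 0%N = P & prime_chain n F.
Proof.
elim=> {n P Q} [P pP|n P P' Q pP PP' _ [F F0 [pF ltF]]].
  by exists (fun=> P).
exists (fun i => if i is j.+1 then F j else P) => //.
split=> -[|i] //; first exact: pF.
  by rewrite F0.
exact: ltF.
Qed.

Lemma pchain_prime n P Q : pchain n P Q -> is_prime_ideal P.
Proof. by case. Qed.

Lemma pchain_sub n P Q : pchain n P Q -> P `<=` Q.
Proof.
elim=> [P0 _|m P0 P' Q0 _ [PP' _] _ P'Q]; first exact: subset_refl.
exact: subset_trans PP' P'Q.
Qed.

Lemma pchain0_inv P Q : pchain 0 P Q -> P = Q.
Proof. by move=> h; inversion h. Qed.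

Lemma pchainS_inv n P Q : pchain n.+1 P Q ->
  exists P', [/\ is_prime_ideal P, P `<` P' & pchain n P' Q].
Proof. by move=> h; inversion h as [|? ? P1]; subst; exists P1. Qed.

(** By induction the tail starting at P1 can be rerouted so that its next prime P2 contains x. The
    principal ideal theorem between P and P2 then replaces P1 by a prime containing x. *)
Lemma pchain_through n P Q x : noetherian B -> pchain n.+1 P Q -> Q x -> ~ P x ->
  exists P', [/\ P' x, P `<` P' & pchain n P' Q].
Proof.
move=> nB; elim: n P => [|n IHn] P.
  move=> /pchainS_inv[P' [pP PP' cP']] Qx Px; exists P'; split=> //.
  by rewrite (pchain0_inv cP').
move=> /pchainS_inv[P1 [pP PP1 cP1]] Qx Px.
have [P1x|P1x] := pselect (P1 x); first by exists P1.
have [P2 [P2x P12 cP2]] := IHn _ cP1 Qx P1x.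
have [P' [pP' PP' P'x P'P2]] := principal_ideal_theorem nB pP (pchain_prime cP1)
   (pchain_prime cP2) PP1 P12 P2x P1x.
exists P'; split=> //; last exact: pchainS P'P2 cP2.
by split=> // /(_ _ P'x).
Qed.

End IdealTheory.

(** * Chains of primes in polynomial rings *)

Lemma preimage_prime (B C : comPzRingType) (h : {rmorphism B -> C}) (P : set C) :
  is_prime_ideal P -> is_prime_ideal (h @^-1` P).
Proof.
move=> pP; have iP := prime_idealW pP; split=> [||x y]; rewrite /preimage /=.
- split=> [|x y|a x] /=; rewrite ?rmorph0 ?rmorphD ?rmorphM.
  + exact: ideal0.
  + exact: idealD.
  + exact: idealM.
- by rewrite rmorph1; apply: primeN1.
- by rewrite rmorphM; apply: primeM.
Qed.

(** * The basis theorem, and the fibres of Spec A[X] over Spec A *)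

Section PolynomialRing.
Variable A : comNzRingType.
Implicit Types (I : set {poly A}) (f g : {poly A}).

Definition coef_ideal I (d : nat) : set A :=
  [set a | exists f, [/\ I f, (size f <= d.+1)%N & f`_d = a]].

Lemma coef_idealP I d : is_ideal I -> is_ideal (coef_ideal I d).
Proof.
move=> iI; split=> [|_ _ [f [If sf <-]] [g [Ig sg <-]]|a _ [f [If sf <-]]].
- by exists 0; rewrite coef0 size_poly0; split=> //; apply: ideal0.
- exists (f + g); rewrite coefD; split=> //; first exact: idealD.
  by rewrite (leq_trans (size_polyD _ _)) // geq_max sf sg.
- exists (a%:P * f); rewrite coefCM mul_polyC; split=> //.
    by rewrite -mul_polyC; apply: idealM.
  by rewrite (leq_trans (size_scale_leq _ _)).
Qed.

Lemma coef_idealS I d e : is_ideal I -> (d <= e)%N ->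
  coef_ideal I d `<=` coef_ideal I e.
Proof.
move=> iI de _ [f [If sf <-]]; exists (f * 'X^(e - d)); split.
- exact: ideal_mulr.
- have [->|f0] := eqVneq f 0; first by rewrite mul0r size_poly0.
  by rewrite (leq_trans (size_polyMleq _ _)) // size_polyXn; lia.
- rewrite coefMXn ltnNge leq_subr /= subKn //.
Qed.

(** Lift finitely many generators of the ideal of degree d coefficients to polynomials in [I]. Their
    multiples by X^(e - d) cancel any degree e coefficient lying in that ideal. *)
Lemma coef_ideal_reduce I d : noetherian A -> is_ideal I ->
  exists s : seq {poly A}, {in s, forall f, I f} /\
    forall J : set {poly A}, is_ideal J -> {in s, forall f, J f} ->
    forall e f, coef_ideal I d f`_e -> (d <= e)%N -> (size f <= e.+1)%N ->
    exists2 g, J g & (size (f - g)%R <= e)%N.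
Proof.
move=> nA iI; have [n [a aE]] := nA _ (coef_idealP d iI).
have /fin_all_exists[F hF] : forall i : 'I_n, exists f,
    [/\ I f, (size f <= d.+1)%N & f`_d = a i].
  move=> i; have : coef_ideal I d (a i) by rewrite aE; apply: span_ideal_gen.
  by [].
exists (codom F); split=> [_ /codomP[i ->]|J iJ JF e f]; first by have [] := hF i.
rewrite aE => -[c ec] de sf.
exists (\sum_i c i *: (F i * 'X^(e - d))).
  apply: ideal_sum => // i; rewrite -mul_polyC; apply: idealM => //.
  by apply: ideal_mulr => //; apply: JF; apply: codom_f.
have sF i : (size (F i * 'X^(e - d))%R <= e.+1)%N.
  have [_ sFi _] := hF i.
  by rewrite (leq_trans (size_polyMleq _ _)) // size_polyXn; lia.
apply/leq_sizeP => j; rewrite leq_eqVlt => /predU1P[<-|ej].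
  rewrite coefB coef_sum ec -sumrB big1 // => i _.
  have [_ _ Fd] := hF i.
  by rewrite coefZ coefMXn ltnNge leq_subr /= subKn // Fd subrr.
rewrite nth_default // (leq_trans (size_polyD _ _)) // size_polyN geq_max.
rewrite (leq_trans sf) //= (leq_trans (size_sum _ _ _)) //.
apply/bigmax_leqP => i _; apply: leq_trans (size_scale_leq _ _) _.
exact: leq_trans (sF i) _.
Qed.

Lemma low_degree_generators I d : noetherian A -> is_ideal I ->
  exists s : seq {poly A}, {in s, forall f, I f} /\
    forall J : set {poly A}, is_ideal J -> {in s, forall f, J f} ->
    forall f, I f -> (size f <= d)%N -> J f.
Proof.
move=> nA iI; elim: d => [|d [s [Is sJ]]].
  exists [::]; split=> // J iJ _ f _; rewrite leqn0 size_poly_eq0 => /eqP->.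
  exact: ideal0.
have [s' [Is' s'J]] := coef_ideal_reduce d nA iI.
exists (s ++ s'); split=> [f|J iJ Jss f If sf].
  by rewrite mem_cat => /orP[/Is|/Is'].
(* Working in the intersection with [I] keeps f - g in [I], so that the induction applies to it. *)
have [f' f's'||g [Jg Ig] sfg] := s'J (J `&` I) (ideal_setI iJ iI) _ d f _ (leqnn d) sf.
- by split; [apply: Jss; rewrite mem_cat f's' orbT|apply: Is'].
- by exists f.
rewrite -(subrK g f); apply: idealD => //.
apply: sJ sfg => //; last exact: idealB.
by move=> h hs; apply: Jss; rewrite mem_cat hs.
Qed.

Theorem hilbert_basis : noetherian A -> noetherian {poly A}.
Proof.
move=> nA I iI.
have [n [a aE]] : exists (n : nat) (g : 'I_n -> A),
    [set b | exists d, coef_ideal I d b] = span_ideal g.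
  apply: nA; split=> [|x y [d Ix] [e Iy]|b x [d Ix]].
  - by exists 0%N; apply: ideal0; apply: coef_idealP.
  - exists (maxn d e); apply: idealD; first exact: coef_idealP.
      by apply: coef_idealS Ix => //; apply: leq_maxl.
    by apply: coef_idealS Iy => //; apply: leq_maxr.
  - by exists d; apply: idealM => //; apply: coef_idealP.
have /fin_all_exists[D hD] : forall i, exists d, coef_ideal I d (a i).
  move=> i; have : span_ideal a (a i) by apply: span_ideal_gen.
  by rewrite -aE.
(* The coefficient ideals increase with the degree and are constant from [N] on. Generators for
   degrees below [N] and for degree [N] therefore suffice. *)
pose N := (\max_i D i)%N.
have allN d : coef_ideal I d `<=` coef_ideal I N.
  move=> b Ib; have : span_ideal a b by rewrite -aE; exists d.
  apply: span_ideal_sub; first exact: coef_idealP.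
  by move=> i; apply: coef_idealS (hD i) => //; apply: leq_bigmax.
have [s [Is sJ]] := low_degree_generators N nA iI.
have [s' [Is' s'J]] := coef_ideal_reduce N nA iI.
apply: (@finitely_generated _ I (s ++ s')) => [//|f|J iJ Jss].
  by rewrite mem_cat => /orP[/Is|/Is'].
have iJI := ideal_setI iJ iI.
suff IJ e : forall f, I f -> (size f <= e)%N -> J f.
  by move=> f If; apply: (IJ (size f)).
elim: e => [|e IHe] f If sf.
  by move: sf; rewrite leqn0 size_poly_eq0 => /eqP->; apply: ideal0.
have [eN|Ne] := ltnP e N.
  apply: sJ => //; last exact: leq_trans sf eN.
  by move=> h hs; apply: Jss; rewrite mem_cat hs.
have [f' f's'||g [Jg Ig] sfg] := s'J (J `&` I) iJI _ e f _ Ne sf.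
- by split; [apply: Jss; rewrite mem_cat f's' orbT|apply: Is'].
- by apply: (allN e); exists f.
rewrite -(subrK g f); apply: idealD => //.
by apply: IHe sfg; apply: idealB.
Qed.

Lemma pseudo_division f g : g != 0 ->
  exists k q r, [/\ lead_coef g ^+ k *: f = q * g + r, (size r < size g)%N &
    (size q + size g <= (size f).+1)%N \/ q = 0].
Proof.
move=> g0; have sg : (0 < size g)%N by rewrite size_poly_gt0.
move: {2}(size f).+1 (ltnSn (size f)) => m; elim: m f => // m IHm f; rewrite ltnS => sf.
have [fg|gf] := ltnP (size f) (size g).
  by exists 0%N, 0, f; rewrite expr0 scale1r mul0r add0r; split=> //; right.
pose d := (size f - size g)%N; pose f' := lead_coef g *: f - lead_coef f *: ('X^d * g).
have sf_gt0 : (0 < size f)%N by apply: leq_trans gf.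
have sf' : (size f' < size f)%N.
  rewrite -(ltn_predK sf_gt0) ltnS; apply/leq_sizeP => j.
  rewrite leq_eqVlt => /predU1P[<-|fj].
    rewrite coefB !coefZ coefXnM /d ltnNge.
    have -> : (size f - size g <= (size f).-1)%N by lia.
    have -> : ((size f).-1 - (size f - size g))%N = (size g).-1 by lia.
    by rewrite /= !lead_coefE mulrC subrr.
  rewrite coefB !coefZ coefXnM ltnNge.
  have -> : (d <= j)%N by rewrite /d; lia.
  have fj' : (size f <= j)%N by lia.
  have gj : (size g <= j - d)%N by rewrite /d; lia.
  by rewrite /= !nth_default // !mulr0 subrr.
have [|k [q [r [e sr sq]]]] := IHm f'; first by lia.
exists k.+1, (q + (lead_coef g ^+ k * lead_coef f) *: 'X^d), r; split=> //.
  rewrite mulrDl -addrA [_ + r]addrC addrA -e /f' scalerBr !scalerA exprSr.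
  by rewrite -scalerAl subrK.
left; have sX : (size ((lead_coef g ^+ k * lead_coef f) *: 'X^d)%R <= d.+1)%N.
  by rewrite (leq_trans (size_scale_leq _ _)) // size_polyXn.
have sq' : (size q <= d.+1)%N by case: sq => [|->]; rewrite ?size_poly0 /d //; lia.
rewrite -[size f](subnK gf) -/d -addSn leq_add2r.
by rewrite (leq_trans (size_polyD _ _)) // geq_max sq' sX.
Qed.

Lemma minimal_size_outside (I J : set {poly A}) : ~ (J `<=` I) ->
  exists f, [/\ J f, ~ I f & forall g, J g -> (size g < size f)%N -> I g].
Proof.
move=> /nonsubset[f0 [Jf0 If0]].
have ex : exists n, `[< exists f, [/\ J f, ~ I f & size f = n] >].
  by exists (size f0); apply/asboolP; exists f0.
case: (ex_minnP ex) => n /asboolP[f [Jf If sf]] minn.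
exists f; split=> // g Jg sg; apply: contrapT => Ig.
have /minn : `[< exists f, [/\ J f, ~ I f & size f = size g] >].
  by apply/asboolP; exists g.
by rewrite -sf leqNgt sg.
Qed.

(** Otherwise the leading term of f is in [I]; removing it leaves a smaller element of [J], which is
    in [I] by minimality, and so f is in [I]. *)
Lemma minimal_size_lead_coef (I J : set {poly A}) f : is_ideal I -> is_ideal J ->
  I `<=` J -> J f -> ~ I f -> (forall g, J g -> (size g < size f)%N -> I g) ->
  ~ I (lead_coef f)%:P.
Proof.
move=> iI iJ IJ Jf If minf Ilf; apply: (If).
have f0 : f != 0 by apply/eqP => f0; apply: If; rewrite f0; apply: ideal0.
pose m := lead_coef f *: 'X^((size f).-1).
have Im : I m by rewrite /m -mul_polyC; apply: ideal_mulr.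
rewrite -(subrK m f); apply: idealD => //; apply: minf.
  by apply: idealB => //; apply: IJ.
have sf : (0 < size f)%N by rewrite size_poly_gt0.
rewrite -(ltn_predK sf) ltnS; apply/leq_sizeP => j.
rewrite leq_eqVlt => /predU1P[<-|fj]; rewrite coefB coefZ coefXn.
  by rewrite eqxx mulr1 lead_coefE subrr.
rewrite [f`_j]nth_default; last by move: fj; rewrite (ltn_predK sf).
by rewrite gtn_eqF // mulr0 subrr.
Qed.

(** Over a field this is the fact that nonzero primes of K[X] are maximal. Here pseudo-division
    plays the role of division over the residue field: if all three primes had the same contraction,
    leading coefficients outside it could be cancelled. *)
Lemma fibre_dimension (Q0 Q1 Q2 : set {poly A}) :
  is_prime_ideal Q0 -> is_prime_ideal Q1 -> is_prime_ideal Q2 ->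
  Q0 `<` Q1 -> Q1 `<` Q2 ->
  exists2 a : A, Q2 a%:P & ~ Q0 a%:P.
Proof.
move=> pQ0 pQ1 pQ2 [Q01 Q10] [Q12 Q21]; apply: contrapT => noa.
have eqC (a : A) : Q2 a%:P -> Q0 a%:P.
  by move=> Q2a; apply: contrapT => Q0a; apply: noa; exists a.
have iQ0 := prime_idealW pQ0; have iQ1 := prime_idealW pQ1.
have iQ2 := prime_idealW pQ2.
have [f [Q1f Q0f minf]] := minimal_size_outside Q10.
have [g [Q2g Q1g ming]] := minimal_size_outside Q21.
have Q0lf := minimal_size_lead_coef iQ0 iQ1 Q01 Q1f Q0f minf.
have Q1lg := minimal_size_lead_coef iQ1 iQ2 Q12 Q2g Q1g ming.
have Q0lg : ~ Q0 (lead_coef g)%:P by move/Q01.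
have f0 : f != 0 by apply/eqP => f0; apply: Q0f; rewrite f0; apply: ideal0.
have g0 : g != 0 by apply/eqP => g0; apply: Q1g; rewrite g0; apply: ideal0.
(* If f were smaller, the remainder of g by f would be in [Q1] by minimality of g, and then so would
   g. *)
have gf : (size g <= size f)%N.
  have [k [q [r [e sr _]]]] := pseudo_division g f0.
  rewrite leqNgt; apply/negP => fg.
  have Q1r : Q1 r.
    apply: ming; last exact: ltn_trans sr fg.
    have -> : r = lead_coef f ^+ k *: g - q * f by rewrite e addrC addKr.
    apply: idealB => //; first by rewrite -mul_polyC; apply: idealM.
    by apply: idealM => //; apply: Q12.
  apply: Q1g; apply: (primeMN pQ1 (x := (lead_coef f ^+ k)%:P)); last first.
    by rewrite mul_polyC e; apply: idealD => //; apply: idealM.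
  by rewrite polyC_exp => /(primeX pQ1)/Q12/eqC.
have [k [q [r [e sr sq]]]] := pseudo_division f g0.
(* A constant g in [Q2] would lie in [Q0]. That g is not constant makes the quotient q smaller than
   f. *)
have sg : (1 < size g)%N.
  rewrite ltnNge; apply/negP => /size1_polyC gC; apply: Q1g; apply: Q01.
  by rewrite gC; apply: eqC; rewrite -gC.
have sf : (0 < size f)%N by rewrite size_poly_gt0.
have Q2r : Q2 r.
  have -> : r = lead_coef g ^+ k *: f - q * g by rewrite e addrC addKr.
  apply: idealB => //; last exact: idealM.
  by rewrite -mul_polyC; apply: idealM => //; apply: Q12.
have Q1r : Q1 r by apply: ming.
have Q0r : Q0 r by apply: minf => //; apply: leq_trans sr gf.
have Q1q : Q1 q.
  have Q1gq : Q1 (g * q).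
    rewrite mulrC -(addrK r (q * g)) -e; apply: idealB => //.
    by rewrite -mul_polyC; apply: idealM.
  exact: primeMN Q1gq.
(* Both q and r are elements of [Q1] smaller than f, hence in [Q0]; so a power of the leading
   coefficient of g times f is in [Q0]. *)
have Q0q : Q0 q by apply: minf => //; case: sq => [|->]; rewrite ?size_poly0; lia.
apply: Q0f; apply: (primeMN pQ0 (x := (lead_coef g ^+ k)%:P)); last first.
  by rewrite mul_polyC e; apply: idealD => //; apply: ideal_mulr.
by rewrite polyC_exp => /(primeX pQ0).
Qed.

(** The lower end is pinned to the contraction of [Q0] so that the induction can prepend a prime.
    Lengths 0 and 1 both yield the trivial chain, which is where one link is lost. *)
Lemma pchain_poly m (Q0 Q : set {poly A}) : noetherian A -> pchain m Q0 Q ->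
  exists k q, (m <= k.+1)%N /\ pchain k (polyC @^-1` Q0) q.
Proof.
move=> nA; elim: m Q0 => [|[|m] IHm] Q0 cQ.
- exists 0%N, (polyC @^-1` Q0); split=> //; apply: pchain0.
  exact: preimage_prime (pchain_prime cQ).
- exists 0%N, (polyC @^-1` Q0); split=> //; apply: pchain0.
  exact: preimage_prime (pchain_prime cQ).
have [Q1 [pQ0 Q01 cQ1]] := pchainS_inv cQ.
have [Q2 [pQ1 Q12 cQ2]] := pchainS_inv cQ1.
have [a Q2a Q0a] := fibre_dimension pQ0 pQ1 (pchain_prime cQ2) Q01 Q12.
have [Q' [Q'a [Q0Q' _] cQ']] :=
  pchain_through (hilbert_basis nA) cQ (pchain_sub cQ2 Q2a) Q0a.
have [k [q [mk ck]]] := IHm _ cQ'.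
exists k.+1, q; split; first by lia.
apply: pchainS ck; first exact: preimage_prime.
by split=> [z /Q0Q'//|/(_ a Q'a)].
Qed.

End PolynomialRing.

Fixpoint iter_poly (A : comNzRingType) (n : nat) : comNzRingType :=
  if n is n'.+1 then {poly iter_poly A n'} else A.

Lemma iter_poly_noetherian (A : comNzRingType) n :
  noetherian A -> noetherian (iter_poly A n).
Proof. by move=> nA; elim: n => //= n; apply: hilbert_basis. Qed.

Lemma pchain_iter_poly (A : comNzRingType) n m (Q0 Q : set (iter_poly A n)) :
  noetherian A -> pchain m Q0 Q ->
  exists k (p q : set A), (m <= k + n)%N /\ pchain k p q.
Proof.
move=> nA; elim: n m Q0 Q => [|n IHn] m Q0 Q cQ.
  by exists m, Q0, Q; rewrite addn0.
have [k [q [mk ck]]] := pchain_poly (@iter_poly_noetherian A n nA) cQ.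
have [k' [p [p' [kk' ck']]]] := IHn _ _ _ ck.
by exists k', p, p'; split=> //; lia.
Qed.

(** An equality of structures, along which morphisms into a ring proved to be nonzero are
    transported. *)
Lemma comNzRing_of_neq (C : comPzRingType) : 1 != 0 :> C ->
  exists C' : comNzRingType, (C' : comPzRingType) = C.
Proof.
move=> C1; pose C' : comNzRingType := HB.pack (GRing.ComPzRing.sort C)
  (GRing.PzSemiRing_isNonZero.Build (GRing.ComPzRing.sort C) C1).
by exists C'; case: C C1 @C'.
Qed.

Lemma iter_poly_morphism (A : comNzRingType) (C : comPzRingType)
    (g : {rmorphism A -> C}) (x : nat -> C) n : 1 != 0 :> C ->
  exists h : {rmorphism iter_poly A n -> C},
    (forall a, exists b, h b = g a) /\ forall i, (i < n)%N -> exists b, h b = x i.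
Proof.
move=> /comNzRing_of_neq[C' eC]; case: C / eC g x => g x.
elim: n => [|n [h [hA hx]]]; first by exists g; split=> // a; exists a.
have cu : commr_rmorph h (x n) by move=> a; apply: mulrC.
exists (horner_morph cu); split=> [a|i].
  by have [b <-] := hA a; exists b%:P; rewrite /= horner_morphC.
rewrite ltnS leq_eqVlt => /predU1P[->|/hx[b <-]].
  by exists 'X; rewrite /= horner_morphX.
by exists b%:P; rewrite /= horner_morphC.
Qed.

(** * Quotients by primes *)

Section DomainOf.
Variables (B : comNzRingType) (mulB0 : forall x y : B, x * y = 0 -> x = 0 \/ y = 0).

(** The proof is an argument of the type so that the domain instances can recover it. *)
Definition domain_of of (forall x y : B, x * y = 0 -> x = 0 \/ y = 0) : Type := B.
Local Notation dom := (domain_of mulB0).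
HB.instance Definition _ := GRing.ComNzRing.on dom.

Definition domain_unit : {pred dom} := [pred x | `[< exists y, y * x = 1 >]].
Definition domain_inv (x : dom) : dom := xget x [set y | y * x = 1].

Lemma domain_mulVx : {in domain_unit, left_inverse 1 domain_inv *%R}.
Proof.
move=> x /asboolP[y yx]; rewrite /domain_inv.
by case: xgetP => [z _ zx|/(_ y) ny]; [exact: zx|case: (ny yx)].
Qed.

Lemma domain_unitP (x y : dom) : y * x = 1 -> domain_unit x.
Proof. by move=> yx; apply/asboolP; exists y. Qed.

Lemma domain_inv_out : {in [predC domain_unit], domain_inv =1 id}.
Proof.
move=> x /asboolPn nx; rewrite /domain_inv.
by case: xgetP => [y _ yx|_]; [case: nx; exists y|].
Qed.

Lemma domain_mulf_eq0 (x y : dom) : x * y = 0 -> (x == 0) || (y == 0).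
Proof. by case/mulB0=> ->; rewrite eqxx ?orbT. Qed.

HB.instance Definition _ := GRing.ComNzRing_hasMulInverse.Build dom
  domain_mulVx domain_unitP domain_inv_out.
HB.instance Definition _ := GRing.ComUnitRing_isIntegral.Build dom domain_mulf_eq0.

End DomainOf.

Section PrimeQuotient.
Variables (A : comNzRingType) (P : set A).
Hypothesis pP : is_prime_ideal P.

Let ideal_pred : {pred A} := fun a => `[< P a >].

Let ideal_pred_closed : idealr_closed ideal_pred.
Proof.
have iP := prime_idealW pP.
split; first by apply/asboolP; apply: ideal0.
  by apply/negP => /asboolP /(primeN1 pP).
move=> a x y /asboolP Px /asboolP Py; apply/asboolP.
by apply: idealD => //; apply: idealM.
Qed.

Lemma prime_quotient : exists (F : idomainType) (h : {rmorphism A -> F}),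
  forall a, h a = 0 <-> P a.
Proof.
pose I : idealr A := HB.pack ideal_pred
  (isIdealr.Build A ideal_pred ideal_pred_closed).
have pi0 (a : A) : (\pi_({ideal_quot I})%qT a = 0 :> {ideal_quot I}) <-> P a.
  have -> : 0 = \pi_({ideal_quot I})%qT 0 :> {ideal_quot I} by rewrite rmorph0.
  split=> [/eqP|Pa]; [|apply/eqP]; rewrite -Quotient.idealrBE subr0.
    by move/asboolP.
  exact/asboolP.
have mul0 (x y : {ideal_quot I}) : x * y = 0 -> x = 0 \/ y = 0.
  elim/quotW: x => x; elim/quotW: y => y.
  by rewrite -rmorphM => /pi0/(primeM pP)[/pi0->|/pi0->]; [left|right].
exists (domain_of mul0), (\pi_({ideal_quot I})%qT : {rmorphism A -> domain_of mul0}).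
exact: pi0.
Qed.

End PrimeQuotient.

(** * Localizations and tensor products *)

(** The unit is [u], with inverse [v]: every element of [C] is a fraction over the image of [B]. An
    ideal of [C] is then determined by its contraction. *)
Definition fraction_surjective (B C : comPzRingType) (h : {rmorphism B -> C}) :=
  forall c : C, exists u v b, v * u = 1 /\ u * c = h b.

Lemma preimage_proper (B C : comPzRingType) (h : {rmorphism B -> C}) (P Q : set C) :
  fraction_surjective h -> is_prime_ideal P -> is_prime_ideal Q -> P `<` Q ->
  h @^-1` P `<` h @^-1` Q.
Proof.
move=> hs pP pQ [PQ QP]; split=> [b /PQ//|hQP]; apply: QP => c Qc.
have [u [v [b [vu uc]]]] := hs c.
rewrite -[c]mul1r -vu -mulrA; apply: idealM; first exact: prime_idealW.
rewrite uc; apply: hQP; rewrite /preimage /= -uc.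
by apply: idealM => //; apply: prime_idealW.
Qed.

Lemma preimage_prime_chain (B C : comPzRingType) (h : {rmorphism B -> C}) n
    (P : nat -> set C) :
  fraction_surjective h -> prime_chain n P -> prime_chain n (fun i => h @^-1` P i).
Proof.
move=> hs [pP ltP]; split=> i in_; first exact/preimage_prime/pP.
by apply: preimage_proper => //; [apply: pP; apply: ltnW|apply: pP|apply: ltP].
Qed.

Section LocalizationPrimes.
Variables (A : comPzRingType) (S : mulrClosed A).
Local Notation L := (localization S).

Definition loc_mk (a s : A) (sS : s \in S) : L :=
  \pi_(L)%qT ((a, exist _ s sS) : loc_frac S).

Lemma loc_mk_eq a s (sS : s \in S) a' s' (s'S : s' \in S) :
  a * s' = a' * s -> loc_mk a sS = loc_mk a' s'S.
Proof. by move=> e; apply: loc_eqP; exists 1; rewrite ?rpred1 //= !mul1r. Qed.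

Lemma loc_mkP (l : L) : exists a s (sS : s \in S), l = loc_mk a sS.
Proof. by elim/quotW: l => -[a [s sS]]; exists a, s, sS. Qed.

Lemma loc_mkD a s (sS : s \in S) a' s' (s'S : s' \in S) :
  loc_mk a sS + loc_mk a' s'S = loc_mk (a * s' + a' * s) (rpredM sS s'S).
Proof. by rewrite [LHS]locD_pi; apply: loc_eqP; exists 1; rewrite ?rpred1. Qed.

Lemma loc_mkM a s (sS : s \in S) a' s' (s'S : s' \in S) :
  loc_mk a sS * loc_mk a' s'S = loc_mk (a * a') (rpredM sS s'S).
Proof. by rewrite [LHS]locM_pi; apply: loc_eqP; exists 1; rewrite ?rpred1. Qed.

Lemma loc_mk1 s (sS : s \in S) : loc_mk s sS = 1.
Proof. by apply: loc_eqP; exists 1; rewrite ?rpred1 //= !mul1r mulr1. Qed.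

Definition loc_emb (a : A) : L := loc_mk a (rpred1 S).

Fact loc_emb_zmod : zmod_morphism loc_emb.
Proof.
move=> a b; apply: (addIr (loc_emb b)); rewrite subrK /loc_emb loc_mkD.
by apply: loc_mk_eq; ring.
Qed.

Fact loc_emb_monoid : monoid_morphism loc_emb.
Proof.
split=> [|a b]; first exact: loc_mk1.
by rewrite /loc_emb loc_mkM; apply: loc_mk_eq; ring.
Qed.

HB.instance Definition _ := GRing.isZmodMorphism.Build A L loc_emb loc_emb_zmod.
HB.instance Definition _ := GRing.isMonoidMorphism.Build A L loc_emb loc_emb_monoid.

Lemma loc_embV s (sS : s \in S) : loc_mk 1 sS * loc_emb s = 1.
Proof.
by rewrite /loc_emb loc_mkM -(loc_mk1 sS); apply: loc_mk_eq; ring.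
Qed.

Lemma loc_emb_fraction_surjective : fraction_surjective loc_emb.
Proof.
move=> l; have [a [s [sS ->]]] := loc_mkP l.
exists (loc_emb s), (loc_mk 1 sS), a; split; first exact: loc_embV.
by rewrite /loc_emb loc_mkM; apply: loc_mk_eq; ring.
Qed.

Lemma prime_loc_disjoint (P : set L) s :
  is_prime_ideal P -> s \in S -> ~ P (loc_emb s).
Proof.
move=> pP sS Ps; apply: (primeN1 pP); rewrite -(loc_embV sS).
by apply: idealM => //; apply: prime_idealW.
Qed.

(** The extension of [Q], read off the chosen representative; [loc_ideal_mk] shows independence of
    that choice when [Q] is prime and avoids [S]. *)
Definition loc_ideal (Q : set A) : set L := [set l | Q (repr l).1].

Lemma loc_ideal_mk (Q : set A) a s (sS : s \in S) : is_prime_ideal Q ->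
  (forall s, s \in S -> ~ Q s) -> loc_ideal Q (loc_mk a sS) <-> Q a.
Proof.
move=> pQ QS; have iQ := prime_idealW pQ.
have [s' s'S /= e] := loc_reprP ((a, exist _ s sS) : loc_frac S).
rewrite /loc_ideal /= /loc_mk; move: e; set r := repr _ => e; split=> [Qr|Qa].
  have Qr2 := QS _ (valP r.2); apply: (primeMN pQ Qr2).
  apply: (primeMN pQ (QS _ s'S)); rewrite mulrCA.
  have -> : sval r.2 * (s' * a) = s' * (a * sval r.2) by ring.
  by rewrite -e; apply: idealM => //; apply: ideal_mulr.
apply: (primeMN pQ (QS _ sS)); apply: (primeMN pQ (QS _ s'S)).
by rewrite [s * _]mulrC e; apply: idealM => //; apply: ideal_mulr.
Qed.

Lemma loc_ideal_prime (Q : set A) : is_prime_ideal Q ->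
  (forall s, s \in S -> ~ Q s) -> is_prime_ideal (loc_ideal Q).
Proof.
move=> pQ QS; have iQ := prime_idealW pQ.
have mkE a s (sS : s \in S) := loc_ideal_mk a sS pQ QS.
split=> [||x y].
- split=> [|x y|x y].
  + by apply/mkE; apply: ideal0.
  + have [a [s [sS ->]]] := loc_mkP x; have [b [t [tS ->]]] := loc_mkP y.
    move=> /mkE Qa /mkE Qb; rewrite loc_mkD; apply/mkE.
    by apply: idealD => //; apply: ideal_mulr.
  + have [a [s [sS ->]]] := loc_mkP x; have [b [t [tS ->]]] := loc_mkP y.
    by move=> /mkE Qb; rewrite loc_mkM; apply/mkE; apply: idealM.
- by rewrite -(loc_mk1 (rpred1 S)) => /mkE; apply: primeN1.
- have [a [s [sS ->]]] := loc_mkP x; have [b [t [tS ->]]] := loc_mkP y.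
  by rewrite loc_mkM => /mkE/(primeM pQ)[Qa|Qb]; [left|right]; apply/mkE.
Qed.

Lemma loc_ideal_proper (Q Q' : set A) : is_prime_ideal Q -> is_prime_ideal Q' ->
  (forall s, s \in S -> ~ Q' s) -> Q `<` Q' -> loc_ideal Q `<` loc_ideal Q'.
Proof.
move=> pQ pQ' Q'S [QQ' Q'Q]; have QS s : s \in S -> ~ Q s by move=> /Q'S + /QQ'.
split=> [l /QQ'//|h]; apply: Q'Q => a Q'a.
apply/(loc_ideal_mk a (rpred1 S) pQ QS)/h.
by apply/(loc_ideal_mk a (rpred1 S) pQ' Q'S).
Qed.

Lemma loc_prime_chain n (Q : nat -> set A) :
  prime_chain n Q -> (forall s, s \in S -> ~ Q n s) ->
  prime_chain n (fun i => loc_ideal (Q i)).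
Proof.
move=> [pQ ltQ] QnS.
have QS i : (i <= n)%N -> forall s, s \in S -> ~ Q i s.
  move=> le_in s sS; suff : Q i `<=` Q n by move=> h Qs; apply: (QnS s sS); apply: h.
  elim: n le_in {pQ QnS} ltQ => [|m IHm].
    by rewrite leqn0 => /eqP-> _; apply: subset_refl.
  rewrite leq_eqVlt => /predU1P[-> _|im ltQ]; first exact: subset_refl.
  apply: subset_trans (properW (ltQ m (leqnn _))).
  by apply: IHm => // j jm; apply: ltQ; apply: ltnW.
split=> i le_in; first by apply: loc_ideal_prime; [apply: pQ|apply: QS].
by apply: loc_ideal_proper; [apply: pQ; apply: ltnW|apply: pQ|apply: QS|apply: ltQ].
Qed.

End LocalizationPrimes.

Section TensorMorphisms.
Variables (R B A : comPzRingType) (f : {rmorphism R -> B}) (g : {rmorphism R -> A}).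
Local Notation T := (tensor f g).

Definition tensor_mk (u : seq (B * A)) : T := \pi_(T)%qT (u : tens_sum B A).

Definition tensor_inl (b : B) : T := tensor_mk [:: (b, 1)].
Definition tensor_inr (a : A) : T := tensor_mk [:: (1, a)].

Fact tensor_inl_zmod : zmod_morphism tensor_inl.
Proof.
move=> a b; apply: (addIr (tensor_inl b)); rewrite subrK.
rewrite /tensor_inl /tensor_mk [LHS]tensorD_pi.
apply: tensor_eqP; apply: tens_trans (tens_sym (tens_Dl _ _ _ _ _)) _.
by rewrite subrK; apply: tens_refl.
Qed.

Fact tensor_inl_monoid : monoid_morphism tensor_inl.
Proof.
split=> // a b; rewrite /tensor_inl /tensor_mk [RHS]tensorM_pi.
by rewrite /tens_mul /= mulr1.
Qed.

HB.instance Definition _ :=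
  GRing.isZmodMorphism.Build B T tensor_inl tensor_inl_zmod.
HB.instance Definition _ :=
  GRing.isMonoidMorphism.Build B T tensor_inl tensor_inl_monoid.

Fact tensor_inr_zmod : zmod_morphism tensor_inr.
Proof.
move=> a b; apply: (addIr (tensor_inr b)); rewrite subrK.
rewrite /tensor_inr /tensor_mk [LHS]tensorD_pi.
apply: tensor_eqP; apply: tens_trans (tens_sym (tens_Dr _ _ _ _ _)) _.
by rewrite subrK; apply: tens_refl.
Qed.

Fact tensor_inr_monoid : monoid_morphism tensor_inr.
Proof.
split=> // a b; rewrite /tensor_inr /tensor_mk [RHS]tensorM_pi.
by rewrite /tens_mul /= mulr1.
Qed.

HB.instance Definition _ :=
  GRing.isZmodMorphism.Build A T tensor_inr tensor_inr_zmod.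
HB.instance Definition _ :=
  GRing.isMonoidMorphism.Build A T tensor_inr tensor_inr_monoid.

Lemma tensor_balanced r : tensor_inl (f r) = tensor_inr (g r).
Proof.
apply: tensor_eqP; have := tens_bal f g r 1 1.
by rewrite !mulr1.
Qed.

Lemma tensor_ind (P : T -> Prop) : P 0 -> (forall x y, P x -> P y -> P (x + y)) ->
  (forall b a, P (tensor_inl b * tensor_inr a)) -> forall x, P x.
Proof.
move=> P0 PD Pba; elim/quotW; elim=> [|[b a] u IHu]; first exact: P0.
have -> : \pi_(T)%qT ((b, a) :: u : tens_sum B A) =
    tensor_inl b * tensor_inr a + \pi_(T)%qT (u : tens_sum B A).
  rewrite /tensor_inl /tensor_inr /tensor_mk [_ * _]tensorM_pi [RHS]tensorD_pi.
  by rewrite /tens_mul /= mulr1 mul1r.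
exact: PD.
Qed.

Section Universal.
Variables (L : comPzRingType) (hB : {rmorphism B -> L}) (hA : {rmorphism A -> L}).
Hypothesis hBA : forall r, hB (f r) = hA (g r).

Let tens_eval (u : seq (B * A)) : L := \sum_(x <- u) hB x.1 * hA x.2.

Let tens_eval_rel u v : tens_rel f g u v -> tens_eval u = tens_eval v.
Proof.
rewrite /tens_eval.
elim=> {u v} [//|//|u v w _ -> _ ->//|u u' v v' _ e _ e'|u v|a|b b' a|b a a'|r b a].
- by rewrite !big_cat /= e e'.
- by rewrite !big_cat /= addrC.
- by rewrite big_seq1 big_nil /= rmorph0 mul0r.
- by rewrite !big_cons !big_nil /= rmorphD mulrDl !addr0.
- by rewrite !big_cons !big_nil /= rmorphD mulrDr !addr0.
- by rewrite !big_seq1 /= !rmorphM hBA; ring.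
Qed.

Let lift (x : T) : L := tens_eval (repr x).

Let liftE u : lift (\pi_(T)%qT u) = tens_eval u.
Proof. exact/tens_eval_rel/tensor_reprP. Qed.

Let lift_zmod : zmod_morphism lift.
Proof.
move=> x y; apply: (addIr (lift y)); rewrite subrK -[X in _ = lift X](subrK y x).
move: (x - y) => z; elim/quotW: z => u; elim/quotW: y => v.
by rewrite [_ + _ in RHS]tensorD_pi !liftE /tens_eval big_cat.
Qed.

Let lift_monoid : monoid_morphism lift.
Proof.
split=> [|x y]; first by rewrite liftE /tens_eval big_seq1 /= !rmorph1 mulr1.
elim/quotW: x => u; elim/quotW: y => v.
rewrite [_ * _ in LHS]tensorM_pi !liftE /tens_eval.
elim: u => [|x u IHu]; first by rewrite !big_nil mul0r.
rewrite tens_mul_cons big_cat big_map big_cons /= IHu mulrDl; congr (_ + _).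
by rewrite mulr_sumr; apply: eq_bigr => y _; rewrite !rmorphM; ring.
Qed.

Lemma tensor_universal : exists psi : {rmorphism T -> L},
  (forall b, psi (tensor_inl b) = hB b) /\ (forall a, psi (tensor_inr a) = hA a).
Proof.
pose zm := GRing.isZmodMorphism.Build T L lift lift_zmod.
pose mm := GRing.isMonoidMorphism.Build T L lift lift_monoid.
pose psi : {rmorphism T -> L} := HB.pack lift zm mm.
exists psi; split=> [b|a]; rewrite [LHS]liftE /tens_eval big_seq1 /=.
  by rewrite rmorph1 mulr1.
by rewrite rmorph1 mul1r.
Qed.

End Universal.
End TensorMorphisms.

(** * Polynomials and rational functions *)

Section PolynomialEvaluation.
Variable I : choiceType.
Implicit Types (m : {cmonom I}).

Definition malgX (R : comNzRingType) (i : I) : {malg R[{cmonom I}]} :=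
  mkmalgU (ucm i) 1.

Lemma malgXM (R : comNzRingType) m m' :
  mkmalgU (mmul m m') 1 = mkmalgU m 1 * mkmalgU m' 1 :> {malg R[{cmonom I}]}.
Proof. by rewrite malgM_def fgmulUU mulr1. Qed.

Lemma cmonom_ind (P : {cmonom I} -> Prop) :
  P mone -> (forall i m, P m -> P (mmul (ucm i) m)) -> forall m, P m.
Proof.
move=> P1 PU m; move: {2}(mdeg m) (erefl (mdeg m)) => d.
elim: d m => [|d IHd] m dm; first by rewrite (mdeg_eq0I dm).
have [i im] : exists i, m i != 0%N.
  apply: contrapT => m0; have : m = mone; last by move=> m1; rewrite m1 mdeg1 in dm.
  apply/eqP/cmP => i; rewrite cm1; apply/eqP; apply: contrapT => /negP mi.
  by apply: m0; exists i.
have mE : m = mmul (ucm i) (divcm m (ucm i)).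
  apply/eqP/cmP => j; rewrite cmM divcmE cmU.
  by case: eqVneq => [<-|_] /=; rewrite ?subn0 //; move: im; lia.
rewrite mE; apply: PU; apply: IHd.
by move: dm; rewrite {1}mE mdegM mdegU => -[].
Qed.

Lemma cmonom_eval1 (A : comNzRingType) (t : I -> A) : cmonom_eval t mone = 1.
Proof. exact: mmorph1. Qed.

Lemma cmonom_evalM (A : comNzRingType) (t : I -> A) m m' :
  cmonom_eval t (mmul m m') = cmonom_eval t m * cmonom_eval t m'.
Proof. exact: mmorphM. Qed.

Lemma cmonom_evalU (A : comNzRingType) (t : I -> A) i : cmonom_eval t (ucm i) = t i.
Proof. by rewrite /cmonom_eval mdomU big_seq_fset1 cmUU expr1. Qed.

Lemma cmonom_eval_malgX (R : comNzRingType) m :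
  cmonom_eval (malgX R) m = mkmalgU m 1.
Proof.
elim/cmonom_ind: m => [|i m IHm]; first by rewrite cmonom_eval1.
by rewrite cmonom_evalM IHm cmonom_evalU malgXM.
Qed.

Lemma pol_evalC (R A : comNzRingType) (f : {rmorphism R -> A}) (t : I -> A) c :
  pol_eval f t (malgC c) = f c.
Proof. exact: mmapC. Qed.

Lemma pol_evalX (R A : comNzRingType) (f : {rmorphism R -> A}) (t : I -> A) i :
  pol_eval f t (malgX R i) = t i.
Proof.
rewrite [LHS]mmapU cmonom_evalU -[RHS]mul1r.
by congr (_ * _); apply: rmorph1.
Qed.

Lemma pol_evalXsubC (R A : comNzRingType) (f : {rmorphism R -> A}) (t : I -> A) i c :
  pol_eval f t (malgX R i - malgC c) = t i - f c.
Proof. by rewrite rmorphB -(pol_evalX f t i) -(pol_evalC f t c). Qed.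

Lemma malgX_neqC (R : comNzRingType) i (c : R) : malgX R i <> malgC c.
Proof.
move=> e; have := congr1 (mcoeff (ucm i)) e.
rewrite /malgX [LHS]mcoeffUU [RHS]mcoeffU.
have -> : (mone == ucm i) = false by rewrite eq_sym; apply: cm1_eq1.
by apply/eqP; apply: oner_neq0.
Qed.

Lemma rmorph_pol_eval (R A B : comNzRingType) (f : {rmorphism R -> A})
    (h : {rmorphism A -> B}) (g : {rmorphism R -> B}) (t : I -> A) (u : I -> B) :
  (forall r, h (f r) = g r) -> (forall i, h (t i) = u i) ->
  forall p, h (pol_eval f t p) = pol_eval g u p.
Proof.
move=> hf ht p; rewrite /pol_eval !mmapE rmorph_sum; apply: eq_bigr => m _.
rewrite rmorphM hf; congr (_ * _); rewrite /cmonom_eval rmorph_prod.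
by apply: eq_bigr => i _; rewrite rmorphXn ht.
Qed.

Lemma pol_eval_coef (R A : comNzRingType) (f : {rmorphism R -> A}) p m :
  (pol_eval (@malgC {cmonom I} A \o f) (malgX A) p)@_m = f p@_m.
Proof.
rewrite /pol_eval mmapE raddf_sum.
rewrite (eq_bigr (fun k => f p@_k * (k == m)%:R)) => [|k _]; last first.
  by rewrite [LHS]mcoeffCM cmonom_eval_malgX mcoeffU1.
have [mp|mp] := boolP (m \in msupp p); last first.
  rewrite (mcoeff_outdom mp) rmorph0 big_seq big1 // => k kp.
  by case: eqP => [km|_]; [rewrite -km kp in mp|rewrite mulr0].
rewrite (big_fsetD1 m mp) eqxx mulr1 big_seq big1 => [|k]; first exact: addr0.
by rewrite in_fsetD1 => /andP[/negPf -> _]; rewrite mulr0.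
Qed.

Lemma pol_eval_id (R : comNzRingType) (p : {malg R[{cmonom I}]}) :
  pol_eval (@malgC {cmonom I} R) (malgX R) p = p.
Proof. by apply/malgP => m; rewrite (pol_eval_coef idfun). Qed.

Lemma malgX_indep (R A : comNzRingType) (f : {rmorphism R -> A}) :
  injective f -> alg_independent (@malgC {cmonom I} A \o f) (malgX A).
Proof.
move=> fI p p0; apply/malgP => m; apply: fI.
by rewrite -pol_eval_coef p0 !mcoeff0 rmorph0.
Qed.

(** With [t] the variables themselves, an induction principle for polynomials, by [pol_eval_id]. *)
Lemma pol_eval_closed (R A : comNzRingType) (f : {rmorphism R -> A}) (t : I -> A)
    (W : set A) :
  (forall x y, W x -> W y -> W (x + y)) -> (forall x y, W x -> W y -> W (x * y)) ->
  (forall r, W (f r)) -> (forall i, W (t i)) -> forall p, W (pol_eval f t p).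
Proof.
move=> WD WM Wf Wt p; rewrite /pol_eval mmapE.
apply: big_ind => // [|m _]; first by rewrite -(rmorph0 f).
apply: (WM) => //; elim/cmonom_ind: m => [|i m Wm].
  by rewrite cmonom_eval1 -(rmorph1 f).
by rewrite cmonom_evalM; apply: WM => //; rewrite cmonom_evalU.
Qed.

End PolynomialEvaluation.

(** * Universal property of a field of fractions *)

Section FractionLift.
Variables (D : comNzRingType) (K : fieldType) (L : comPzRingType).
Variables (e : {rmorphism D -> K}) (h : {rmorphism D -> L}).
Hypothesis e_inj : injective e.
Hypothesis frac : forall b, exists p q, q != 0 /\ b * e q = e p.
Hypothesis h_unit : forall q, q != 0 -> exists v, v * h q = 1.

(** A fraction p/q is sent to h(p)/h(q). The value is unique because the images of denominators are
    units. *)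
Let graph (b : K) (l : L) : Prop :=
  exists p q, [/\ q != 0, b * e q = e p & l * h q = h p].

Let graph_ex b : exists l, graph b l.
Proof.
have [p [q [q0 bq]]] := frac b; have [v vq] := h_unit q0.
by exists (h p * v), p, q; rewrite -mulrA vq mulr1.
Qed.

Let graph_uniq b l l' : graph b l -> graph b l' -> l = l'.
Proof.
move=> [p [q [q0 bq lq]]] [p' [q' [q0' bq' lq']]].
have pq : p * q' = p' * q by apply: e_inj; rewrite !rmorphM -bq -bq'; ring.
have [v vq] := h_unit q0; have [v' vq'] := h_unit q0'.
have llE : l * (h q * h q') = l' * (h q * h q').
  transitivity (h (p * q')); first by rewrite rmorphM -lq; ring.
  by rewrite pq rmorphM -lq'; ring.
have qq : (h q * h q') * (v * v') = 1.
  transitivity ((v * h q) * (v' * h q')); first by ring.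
  by rewrite vq vq' mulr1.
by rewrite -[l]mulr1 -[l']mulr1 -qq !mulrA -[l * _ * _]mulrA llE !mulrA.
Qed.

Let lift (b : K) : L := sval (cid (graph_ex b)).

Let liftP b : graph b (lift b). Proof. exact: svalP (cid (graph_ex b)). Qed.

Let neq0M (q q' : D) : q != 0 -> q' != 0 -> q * q' != 0.
Proof.
move=> q0 q0'; rewrite -(inj_eq e_inj) rmorph0 rmorphM mulf_neq0 //.
  by rewrite -(rmorph0 e) (inj_eq e_inj).
by rewrite -(rmorph0 e) (inj_eq e_inj).
Qed.

Let lift_zmod : zmod_morphism lift.
Proof.
move=> b b'; apply: graph_uniq (liftP _) _.
have [p [q [q0 bq lq]]] := liftP b; have [p' [q' [q0' bq' lq']]] := liftP b'.
exists (p * q' - p' * q), (q * q'); rewrite neq0M // !rmorphB !rmorphM.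
by rewrite -bq -bq' -lq -lq'; split=> //; ring.
Qed.

Let lift_monoid : monoid_morphism lift.
Proof.
split=> [|b b'].
  apply: graph_uniq (liftP _) _; exists 1, 1.
  by rewrite oner_neq0 !rmorph1 !mulr1.
apply: graph_uniq (liftP _) _.
have [p [q [q0 bq lq]]] := liftP b; have [p' [q' [q0' bq' lq']]] := liftP b'.
exists (p * p'), (q * q'); rewrite neq0M // !rmorphM.
by rewrite -bq -bq' -lq -lq'; split=> //; ring.
Qed.

Lemma fraction_lift : exists H : {rmorphism K -> L}, forall p, H (e p) = h p.
Proof.
pose zm := GRing.isZmodMorphism.Build K L lift lift_zmod.
pose mm := GRing.isMonoidMorphism.Build K L lift lift_monoid.
pose H : {rmorphism K -> L} := HB.pack lift zm mm.
exists H => p; apply: graph_uniq (liftP _) _.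
by exists p, 1; rewrite oner_neq0 !rmorph1 !mulr1.
Qed.

End FractionLift.

(** * Clearing denominators *)

Section Denominators.
Variables (S T : comNzRingType) (M : {rmorphism S -> T}) (D : set S).
Hypothesis D_mul : forall x y, D x -> D y -> D (x * y).

Definition fractions_of : set T := [set x | exists d p, D d /\ x * M d = M p].

Lemma fractions_ofD x y : fractions_of x -> fractions_of y -> fractions_of (x + y).
Proof.
move=> [d [p [Dd xd]]] [d' [p' [Dd' yd']]]; exists (d * d'), (p * d' + p' * d).
by split; [apply: D_mul|rewrite !rmorphD !rmorphM -xd -yd'; ring].
Qed.

Lemma fractions_ofM x y : fractions_of x -> fractions_of y -> fractions_of (x * y).
Proof.
move=> [d [p [Dd xd]]] [d' [p' [Dd' yd']]]; exists (d * d'), (p * p').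
by split; [apply: D_mul|rewrite !rmorphM -xd -yd'; ring].
Qed.

End Denominators.

Lemma fractions_of_trans (S : comNzRingType) (T : idomainType) (K : fieldType)
    (M : {rmorphism S -> T}) (e : {rmorphism T -> K}) (D : set S) (P Q : T) (b : K) :
  (forall d, D d -> M d != 0) -> fractions_of M D P -> fractions_of M D Q ->
  Q != 0 -> b * e Q = e P ->
  exists p q, M q != 0 /\ b * e (M q) = e (M p).
Proof.
move=> D0 [r [p [Dr pE]]] [s [q [Ds qE]]] Q0 bQ; exists (p * s), (q * r).
rewrite !rmorphM -pE -qE !rmorphM -bQ !mulf_neq0 ?D0 //; split=> //.
by ring.
Qed.

Section RationalFunctions.
Variables (R : idomainType) (I : choiceType).
Local Notation K := (ratfun R I).

Definition ratfunX (i : I) : K := FracField.tofrac (malgX {fraction R} i).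

(** The inclusion of R[X] in K(X). As [ratfun] is built from polynomials over the fraction field of
    [R], [ratfun_eval_inj] and [ratfun_fraction] are there to show that it is also the fraction
    field of R[X]. *)
Definition ratfun_eval : {malg R[{cmonom I}]} -> K := pol_eval (ratfun_of R I) ratfunX.
HB.instance Definition _ := GRing.RMorphism.on ratfun_eval.

Lemma fraction_numden (D : idomainType) (x : {fraction D}) :
  exists p q : D, q != 0 /\ x * FracField.tofrac q = FracField.tofrac p.
Proof.
elim/quotW: x => r; exists \n_r, \d_r; split; first exact: denom_ratioP.
unlock FracField.tofrac; rewrite -[LHS]FracField.pi_mul.
apply/eqmodP; rewrite /= FracField.equivfE /FracField.mulf.
by rewrite !numden_Ratio ?mulr1 ?oner_neq0 ?denom_ratioP // mulrC.
Qed.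

Lemma ratfun_evalE p : ratfun_eval p = FracField.tofrac
  (pol_eval (@malgC {cmonom I} {fraction R} \o @FracField.tofrac R)
     (malgX {fraction R}) p).
Proof. by symmetry; apply: rmorph_pol_eval. Qed.

Lemma ratfun_eval_inj : injective ratfun_eval.
Proof.
move=> p q pq; have : ratfun_eval (p - q) = 0 by rewrite rmorphB /= pq subrr.
rewrite ratfun_evalE => /eqP; rewrite tofrac_eq0 => /eqP pq0.
apply/eqP; rewrite -subr_eq0; apply/eqP; apply: malgX_indep pq0 => x y /eqP.
by rewrite tofrac_eq => /eqP.
Qed.

Lemma malg_fraction_clear (P : {malg {fraction R}[{cmonom I}]}) :
  fractions_of (pol_eval (@malgC {cmonom I} {fraction R} \o @FracField.tofrac R)
       (malgX {fraction R})) [set q | exists2 r : R, r != 0 & q = malgC r] P.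
Proof.
set M : {rmorphism _ -> _} := pol_eval _ _.
have MC r : M (malgC r) = malgC (FracField.tofrac r) by exact: pol_evalC.
have MX i : M (malgX R i) = malgX {fraction R} i by exact: pol_evalX.
clearbody M.
have D_mul (x y : {malg R[{cmonom I}]}) : (exists2 r : R, r != 0 & x = malgC r) ->
    (exists2 r : R, r != 0 & y = malgC r) -> exists2 r : R, r != 0 & x * y = malgC r.
  move=> [r r0 ->] [s s0 ->]; exists (r * s); first exact: mulf_neq0.
  by rewrite mpolyCM.
rewrite -(pol_eval_id P); apply: pol_eval_closed => [|| c |i].
- exact: fractions_ofD.
- exact: fractions_ofM.
- have [p [q [q0 cq]]] := fraction_numden c.
  exists (malgC q), (malgC p); split; first by exists q.
  transitivity (malgC (FracField.tofrac p) : {malg {fraction R}[{cmonom I}]}).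
    by rewrite -cq mpolyCM; congr (_ * _); apply: MC.
  by symmetry; apply: MC.
- exists (malgC 1), (malgX R i); split; first by exists 1; [apply: oner_neq0|].
  transitivity (malgX {fraction R} i); last by symmetry; apply: MX.
  rewrite -[RHS]mulr1; congr (_ * _); apply: etrans (MC 1) _.
  by rewrite tofrac1 mpolyC1E.
Qed.

Lemma ratfun_fraction (b : K) :
  exists p q, q != 0 /\ b * ratfun_eval q = ratfun_eval p.
Proof.
have [P [Q [Q0 bQ]]] := fraction_numden b.
set D := [set q : {malg R[{cmonom I}]} | exists2 r : R, r != 0 & q = malgC r].
set M : {rmorphism {malg R[{cmonom I}]} -> {malg {fraction R}[{cmonom I}]}} :=
  pol_eval (@malgC {cmonom I} {fraction R} \o @FracField.tofrac R) (malgX {fraction R}).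
have D0 d : D d -> M d != 0.
  move=> [x x0 ->]; have -> : M (malgC x) = malgC (FracField.tofrac x).
    exact: pol_evalC.
  apply/eqP => /(congr1 (mcoeff mone)); rewrite [LHS]malgCK mcoeff0 => /eqP.
  by rewrite tofrac_eq0 (negPf x0).
have [p [q [Mq0 bq]]] :=
  fractions_of_trans D0 (malg_fraction_clear P) (malg_fraction_clear Q) Q0 bQ.
exists p, q; rewrite !ratfun_evalE; split=> //.
by apply/eqP => q0; move: Mq0; rewrite q0 rmorph0 eqxx.
Qed.

End RationalFunctions.

(** * Krull dimension *)

Section KrullDimension.
Variable A : comPzRingType.

Let lengths : set nat := [set n | exists P : nat -> set A, prime_chain n P].
Let elengths : set (\bar int) := [set n%:Z%:E | n in lengths].

(** [supremum] is meaningful only if a least upper bound exists: the maximum when the lengths are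
    bounded, and +oo otherwise. *)
Let supremums_elengths : elengths !=set0 -> supremums elengths !=set0.
Proof.
move=> [_ [n0 Ln0 _]].
have [[b Lb]|unbounded] := pselect (exists b, forall n, lengths n -> (n <= b)%N).
  have exL : exists n, `[< lengths n >] by exists n0; apply/asboolP.
  have ubL n : `[< lengths n >] -> (n <= b)%N by move/asboolP/Lb.
  case: (ex_maxnP exL ubL) => N /asboolP LN maxN.
  exists N%:Z%:E; split=> [_ [n Ln <-]|y]; last by apply; exists N.
  by rewrite lee_fin lez_nat maxN //; apply/asboolP.
exists +oo%E; split=> [x _|y uby]; first exact: leey.
case: y uby => [r| |] uby; [exfalso|exact: leey|exfalso].
  apply: unbounded; exists `|r|%N => n Ln.
  have : (n%:Z%:E <= r%:E)%E by apply: uby; exists n.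
  by rewrite lee_fin -lez_nat => /le_trans; apply; lia.
by have : (n0%:Z%:E <= -oo :> \bar int)%E by apply: uby; exists n0.
Qed.

Lemma krull_dim_ge n (P : nat -> set A) :
  prime_chain n P -> (n%:Z%:E <= krull_dim A)%E.
Proof.
move=> cP; have En : elengths n%:Z%:E by exists n => //; exists P.
by apply: ge_supremum_Nmem => //; apply: supremums_elengths; exists n%:Z%:E.
Qed.

Lemma krull_dim_le (y : \bar int) :
  (forall n (P : nat -> set A), prime_chain n P -> (n%:Z%:E <= y)%E) ->
  (krull_dim A <= y)%E.
Proof.
move=> leny; rewrite /krull_dim /supremum; case: ifPn => [_|/set0P E0].
  exact: leNye.
have [s sE] := supremums_elengths E0.
case: xgetP => [z _ [_ leastz]|/(_ s) //]; apply: leastz => _ [n [P cP] <-].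
exact: leny cP.
Qed.

Lemma krull_dim_pinfty :
  (forall n, exists P : nat -> set A, prime_chain n P) -> krull_dim A = +oo%E.
Proof.
move=> chains; have geN n : (n%:Z%:E <= krull_dim A)%E.
  by have [P cP] := chains n; apply: krull_dim_ge cP.
case: (krull_dim A) geN => [r| |] // geN; last by have := geN 0%N.
by have := geN `|r|.+1%N; rewrite lee_fin; lia.
Qed.

End KrullDimension.

(** * Chains of primes in the tensor product *)

Lemma kernel_prime (B : comPzRingType) (F : idomainType) (h : {rmorphism B -> F}) :
  is_prime_ideal [set b | h b = 0].
Proof.
split=> [||x y] /=.
- split=> [|x y /= hx hy|a x /= hx]; first exact: rmorph0.
    by rewrite rmorphD hx hy addr0.
  by rewrite rmorphM hx mulr0.
- by rewrite rmorph1; apply/eqP; apply: oner_neq0.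
- by rewrite rmorphM => /eqP; rewrite mulf_eq0 => /orP[]/eqP; [left|right].
Qed.

Lemma prime_avoiding (A : comPzRingType) (S : mulrClosed A) : 0 \notin S ->
  exists2 P : set A, is_prime_ideal P & forall s, s \in S -> ~ P s.
Proof.
move=> S0.
(* Membership of 0 is left out so that the empty chain has an admissible union; the maximal [M] is
   shown to be nonempty afterwards, by comparison with the zero ideal. *)
have [|M [[MD MM MS] Mmax]] := @Zorn_bigcup A (fun X => [/\
    forall x y, X x -> X y -> X (x + y), forall a x, X x -> X (a * x) &
    forall s, s \in S -> ~ X s]).
  move=> G Gid totG; split=> [x y [X GX Xx] [Y GY Yy]|a x [X GX Xx]|s sS [X GX Xs]].
  - have [XY|YX] := totG _ _ GX GY.
      by exists Y => //; have [D _ _] := Gid _ GY; apply: D => //; apply: XY.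
    by exists X => //; have [D _ _] := Gid _ GX; apply: D => //; apply: YX.
  - by exists X => //; have [_ D _] := Gid _ GX; apply: D.
  - by have [_ _ D] := Gid _ GX; apply: D Xs.
have [x0 Mx0] : M !=set0.
  apply/set0P/eqP => M0; apply: (Mmax [set 0]).
    by rewrite M0; split=> // /(_ 0); apply.
  split=> [x y /= -> ->|a x /= ->|s sS /= s0]; rewrite ?addr0 ?mulr0 //.
  by rewrite s0 (negPf S0) in sS.
have iM : is_ideal M by split=> //; rewrite -(mul0r x0); apply: MM.
have extend x : ~ M x -> exists s m r, [/\ s \in S, M m & s = m + r * x].
  move=> Mx; apply: contrapT => noS.
  have ix : is_ideal (sum_ideal M (principal x)).
    by apply: sum_idealP => //; apply: principal_ideal.
  apply: (Mmax (sum_ideal M (principal x))).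
    split; first by apply: sum_ideall; apply: principal_ideal.
    by move/(_ x) => h; apply/Mx/h/sum_idealr => //; apply: principal_gen.
  split=> [y z|a y|s sS [m [_ [Mm [r ->] e]]]]; [exact: idealD|exact: idealM|].
  by apply: noS; exists s, m, r.
exists M => //; split=> // [M1|x y Mxy]; first exact: (MS 1 (rpred1 S)).
apply: contrapT => /not_orP[Mx My].
have [s [m [r [sS Mm es]]]] := extend x Mx.
have [s' [m' [r' [s'S Mm' es']]]] := extend y My.
apply: (MS (s * s')); first exact: rpredM.
have -> : s * s' = s' * m + r * x * m' + r * r' * (x * y).
  by rewrite {1}es mulrDl [m * s']mulrC -addrA; congr (_ + _); rewrite es'; ring.
by apply: (MD); [apply: MD|]; apply: MM.
Qed.

Section TensorToLocalization.
Variables (R : idomainType) (A : comNzRingType) (iota : {rmorphism R -> A}).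
Hypothesis iota_inj : injective iota.
Variable I : choiceType.
Local Notation T := (tensor (ratfun_of R I) iota).
Local Notation AX := {malg A[{cmonom I}]}.
Local Notation X_indep := (malgX_indep (I := I) iota_inj).

(** Nonzero polynomials over [R] become units in the target, so K(X) maps there and agrees with [A]
    on [R]. The image contains [A] and the variables, hence A[X], and every element is a fraction of
    such. *)
Lemma tensor_localization :
  exists psi : {rmorphism T -> localization (adjoin_nz X_indep)},
    fraction_surjective psi.
Proof.
set S := adjoin_nz X_indep.
pose ev : {rmorphism {malg R[{cmonom I}]} -> AX} :=
  pol_eval (@malgC {cmonom I} A \o iota) (malgX A).
have evS q : q != 0 -> ev q \in S.
  move=> q0; apply/asboolP; split; first by exists q.
  by move/X_indep/eqP; rewrite (negPf q0).
have h_unit q : q != 0 -> exists v, v * (loc_emb S \o ev) q = 1.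
  by move=> /evS qS; exists (loc_mk 1 qS); apply: loc_embV.
have [H HE] := fraction_lift (@ratfun_eval_inj R I) (@ratfun_fraction R I) h_unit.
pose hA : {rmorphism A -> localization S} := loc_emb S \o @malgC {cmonom I} A.
have agree r : H (ratfun_of R I r) = hA (iota r).
  have -> : ratfun_of R I r = ratfun_eval (malgC r) by rewrite [RHS]pol_evalC.
  by rewrite HE /= [ev _]pol_evalC.
have [psi [psil psir]] := tensor_universal agree.
exists psi => l; have [c [s [sS ->]]] := loc_mkP l.
pose W : set AX := [set c | exists x, psi x = loc_emb S c].
have [x ex] : W c.
  rewrite -(pol_eval_id c); apply: pol_eval_closed.
  - by move=> a b [x ex] [y ey]; exists (x + y); rewrite !rmorphD ex ey.
  - by move=> a b [x ex] [y ey]; exists (x * y); rewrite !rmorphM ex ey.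
  - by move=> a; exists (tensor_inr _ _ a); rewrite psir.
  - move=> i; exists (tensor_inl _ _ (ratfun_eval (malgX R i))).
    by rewrite psil HE /= [ev _]pol_evalX.
exists (loc_emb S s), (loc_mk 1 sS), x; split; first exact: loc_embV.
by rewrite ex /loc_emb loc_mkM; apply: loc_mk_eq; ring.
Qed.

Lemma tensor_prime_chain n (Q : nat -> set AX) : prime_chain n Q ->
  (forall p : {malg R[{cmonom I}]}, p != 0 ->
    ~ Q n (pol_eval (@malgC {cmonom I} A \o iota) (malgX A) p)) ->
  exists Q' : nat -> set T, prime_chain n Q'.
Proof.
move=> cQ Qn; have [psi psi_surj] := tensor_localization.
exists (fun i => psi @^-1` @loc_ideal _ (adjoin_nz X_indep) (Q i)).
apply: preimage_prime_chain => //; apply: loc_prime_chain => // s.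
move=> /asboolP[[p ->] p0]; apply: Qn.
by apply/eqP => p_eq0; apply: p0; rewrite p_eq0 rmorph0.
Qed.

Variables (t : I -> A) (t_indep : alg_independent iota t).

(** * The lower bound *)

Section Chain.
Variables (rank : I -> nat) (n : nat).
Hypothesis rank_onto : forall k, (k < n)%N -> exists i, rank i = k.
Variables (m : nat) (P : nat -> set A).
Hypothesis cP : prime_chain m P.
Hypothesis P_avoids : forall s, s \in adjoin_nz t_indep -> ~ P m s.

(* Below the chain pulled back along [X := t], substitute the variables one   *)
(* at a time, in the order of their ranks, modulo the prime [P 0].            *)
Lemma tensor_prime_chain_lift : exists Q : nat -> set T, prime_chain (n + m) Q.
Proof.
have [pP ltP] := cP.
have [F [q qP0]] := prime_quotient (pP 0%N isT).
pose ev : {rmorphism AX -> A} := pol_eval (idfun : {rmorphism A -> A}) t.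
pose u k i : {malg F[{cmonom I}]} :=
  if (rank i < k)%N then malgC (q (t i)) else malgX F i.
pose sub k : {rmorphism AX -> {malg F[{cmonom I}]}} :=
  pol_eval (@malgC {cmonom I} F \o q) (u k).
pose Z k : set AX := [set p | sub k p = 0].
have evX i : ev (malgX A i - malgC (t i)) = 0.
  by apply: etrans (pol_evalXsubC _ _ _ _) _; rewrite subrr.
have subX k i : sub k (malgX A i - malgC (t i)) = u k i - malgC (q (t i)).
  exact: pol_evalXsubC.
have ZS k : (k < n)%N -> ~ (forall p, sub k.+1 p = 0 -> Z k p).
  move=> /rank_onto[i ik] h.
  have s1 : sub k.+1 (malgX A i - malgC (t i)) = 0.
    by apply: etrans (subX _ _) _; rewrite /u ik ltnSn subrr.
  have := etrans (esym (subX k i)) (h _ s1).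
  by rewrite /u ik ltnn => /subr0_eq/malgX_neqC.
have ZSsub k p : Z k p -> sub k.+1 p = 0.
  pose sg : {rmorphism {malg F[{cmonom I}]} -> {malg F[{cmonom I}]}} :=
    pol_eval (@malgC {cmonom I} F) (u k.+1).
  have <- : sg (sub k p) = sub k.+1 p.
    apply: rmorph_pol_eval => [a|i]; first exact: pol_evalC.
    rewrite /u; case: ifP => ik; last exact: pol_evalX.
    by rewrite [LHS]pol_evalC ltnS (ltnW ik).
  by rewrite /Z /= => ->; rewrite rmorph0.
have Z_ev k p : Z k p -> P 0%N (ev p).
  (* Substituting the remaining variables shows that evaluation at t modulo [P 0] factors through
     each [sub k]. *)
  pose sg : {rmorphism {malg F[{cmonom I}]} -> F} :=
    pol_eval (idfun : {rmorphism F -> F}) (q \o t).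
  have sgE : sg (sub k p) = q (ev p).
    transitivity (pol_eval q (q \o t) p); last first.
      by symmetry; apply: rmorph_pol_eval.
    apply: rmorph_pol_eval => [a|i]; first exact: pol_evalC.
    by rewrite /u; case: ifP => ik; [exact: pol_evalC|exact: pol_evalX].
  by move=> Zp; apply/qP0; rewrite -sgE Zp rmorph0.
(* The n kernels [Z 0], ..., [Z (n - 1)] come first; index n is already the preimage of [P 0]. *)
pose Q i : set AX := if (i < n)%N then Z i else ev @^-1` P (i - n)%N.
apply: (@tensor_prime_chain (n + m) Q); last first.
  move=> p p0; rewrite /Q ltnNge leq_addr addKn /=.
  have evE : ev (pol_eval (@malgC {cmonom I} A \o iota) (malgX A) p) =
      pol_eval iota t p.
    by apply: rmorph_pol_eval => [a|i]; [exact: pol_evalC|exact: pol_evalX].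
  rewrite /preimage /= evE; apply: P_avoids; apply/asboolP; split; first by exists p.
  by move/t_indep/eqP; rewrite (negPf p0).
split=> i le_i; rewrite /Q.
  case: ltnP => ni; first exact: kernel_prime.
  by apply: preimage_prime; apply: pP; lia.
case: (ltnP i n) => [ilt|nle]; last first.
  have -> : (i.+1 < n)%N = false by lia.
  rewrite subSn //; have [le1 nle1] : P (i - n)%N `<` P (i - n).+1 by apply: ltP; lia.
  split=> [p /le1//|h]; apply: nle1 => a Pa.
  have evC : ev (malgC a) = a by exact: pol_evalC.
  by have := h (malgC a); rewrite /preimage /= evC; apply.
case: ltnP => [_|nle]; first by split=> [p|h]; [exact: ZSsub|exact: ZS h].
(* At the junction i = n - 1, the variable of rank i minus its t-value separates [Z i] from the
   preimage of [P 0]. *)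
have -> : (i.+1 - n = 0)%N by lia.
split=> [p|h]; first exact: Z_ev.
have [j ji] := rank_onto ilt.
have Pe : (ev @^-1` P 0%N) (malgX A j - malgC (t j)).
  by rewrite /preimage /= evX; apply: ideal0; apply: prime_idealW; apply: pP.
have := etrans (esym (subX i j)) (h _ Pe).
by rewrite /u ji ltnn => /subr0_eq/malgX_neqC.
Qed.

End Chain.
End TensorToLocalization.

(** * The upper bound *)

Section IteratedPolynomialsToTensor.
Variables (R : idomainType) (A : comNzRingType) (iota : {rmorphism R -> A}) (n : nat).
Local Notation T := (tensor (ratfun_of R 'I_n) iota).

Lemma iter_poly_tensor : 1 != 0 :> T ->
  exists theta : {rmorphism iter_poly A n -> T}, fraction_surjective theta.
Proof.
move=> T1; pose inl := tensor_inl (ratfun_of R 'I_n) iota.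
pose inr := tensor_inr (ratfun_of R 'I_n) iota.
pose x (i : nat) : T := if insub i is Some j then inl (ratfunX R j) else 0.
have [theta [hA hx]] := iter_poly_morphism inr x n T1.
exists theta.
pose W : set T := [set d | exists b, theta b = d].
have WD y z : W y -> W z -> W (y + z).
  by move=> [b <-] [c <-]; exists (b + c); rewrite rmorphD.
have WM y z : W y -> W z -> W (y * z).
  by move=> [b <-] [c <-]; exists (b * c); rewrite rmorphM.
have Wpol p : W (inl (ratfun_eval p)).
  apply: (@pol_eval_closed _ _ _ _ _ (inl @^-1` W)) => [y z|y z|r|i];
    rewrite /preimage /=.
  - by rewrite /inl rmorphD; apply: WD.
  - by rewrite /inl rmorphM; apply: WM.
  - by rewrite /inl tensor_balanced; apply: hA.
  - have := hx i (ltn_ord i); rewrite /x.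
    by case: insubP => [j _ /val_inj->|]; rewrite ?ltn_ord.
have inlM b c : inl (b * c) = inl b * inl c by apply: rmorphM.
have evM p q : ratfun_eval (p * q) = ratfun_eval p * ratfun_eval q :> ratfun R 'I_n.
  exact: rmorphM.
(* A common denominator in R[X] for the finitely many pure tensors of d; it is a unit because K(X)
   is a field. *)
have frac d : exists q, q != 0 /\ W (inl (ratfun_eval q) * d).
  elim/tensor_ind: d => [|y z [q [q0 Wq]] [r [r0 Wr]]|b a].
  - exists 1; rewrite oner_neq0; split=> //; exists 0.
    by rewrite rmorph0 mulr0.
  - exists (q * r); split; first exact: mulf_neq0.
    rewrite evM inlM mulrDr; apply: WD; last by rewrite -mulrA; apply: WM.
    by rewrite [inl _ * _]mulrC -mulrA; apply: WM.
  - have [p [q [q0 bq]]] := ratfun_fraction b.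
    exists q; split=> //; rewrite mulrA -inlM mulrC [_ * b]mulrC bq mulrC.
    by apply: WM => //; apply: hA.
move=> d; have [q [q0 [b eb]]] := frac d.
exists (inl (ratfun_eval q)), (inl (ratfun_eval q)^-1), b; split=> //.
rewrite -inlM mulVf; first exact: rmorph1.
apply/eqP => e0.
by move/eqP: q0; apply; apply: ratfun_eval_inj; rewrite e0 rmorph0.
Qed.

Lemma tensor_krull_dim_le : noetherian A ->
  (krull_dim T <= krull_dim A + n%:Z%:E)%E.
Proof.
move=> nA; apply: krull_dim_le => m P cP.
(* The chain at hand contains a prime, so the tensor product is nonzero. *)
have T1 : 1 != 0 :> T.
  have [pP _] := cP; have p0 := pP 0%N isT.
  apply/eqP => e; apply: (primeN1 p0); rewrite e.
  by apply: ideal0; apply: prime_idealW p0.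
have [theta thetaS] := iter_poly_tensor T1.
have /prime_chain_pchain/(pchain_iter_poly nA) := preimage_prime_chain thetaS cP.
move=> [k [p [p' [mk /pchain_prime_chain[F _ cF]]]]].
apply: (@le_trans _ _ (k%:Z%:E + n%:Z%:E)%E).
  by rewrite -EFinD lee_fin -PoszD lez_nat.
by apply: leeD2r; apply: krull_dim_ge cF.
Qed.

End IteratedPolynomialsToTensor.

Theorem theorem2p1 (R : idomainType) (A : comNzRingType)
    (iota : {rmorphism R -> A}) (iota_inj : injective iota) :
  (forall (n : nat) (t : 'I_n -> A) (t_indep : alg_independent iota t),
     (n%:Z%:E + krull_dim (localization (adjoin_nz t_indep))
        <= krull_dim (tensor (ratfun_of R 'I_n) iota))%E
     /\ (noetherian A ->
         (krull_dim (tensor (ratfun_of R 'I_n) iota)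
            <= krull_dim A + n%:Z%:E)%E))
  /\ (forall t : nat -> A, alg_independent iota t ->
        krull_dim (tensor (ratfun_of R nat) iota) = +oo%E).
Proof.
split=> [n t t_indep|t t_indep].
  split; last exact: tensor_krull_dim_le.
  (* Moving the finite n across reduces the bound on a supremum to one on each chain. *)
  rewrite -leeBrDl //; apply: krull_dim_le => m P cP.
  rewrite leeBrDl // -EFinD -PoszD.
  have cP' :=
    preimage_prime_chain (@loc_emb_fraction_surjective _ (adjoin_nz t_indep)) cP.
  have rank_onto k : (k < n)%N -> exists i : 'I_n, i = k :> nat.
    by move=> kn; exists (Ordinal kn).
  have [|Q cQ] :=
    @tensor_prime_chain_lift _ _ _ iota_inj _ _ t_indep _ _ rank_onto _ _ cP'.
    move=> s sS; apply: prime_loc_disjoint sS.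
    by have [pP _] := cP; apply: pP.
  exact: krull_dim_ge cQ.
have S0 : 0 \notin adjoin_nz t_indep by apply/negP => /asboolP[].
have [P pP avoids] := prime_avoiding S0.
apply: krull_dim_pinfty => n.
(* A single prime avoiding R[t] \ {0} is enough: any number n of the infinitely many variables adds
   n links below it. *)
have cP : prime_chain 0 (fun=> P) by split.
have rank_onto k : (k < n)%N -> exists i : nat, i = k by exists k.
have [Q cQ] := tensor_prime_chain_lift iota_inj rank_onto cP avoids.
by exists Q; rewrite addn0 in cQ.
Qed.
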